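(* There exists a universal constant $C>0$ such that the following holds. Let $n\ge 1$ and $r\ge 2$ be integers, let $\varepsilon\in(0,1)$, and let $T\in(\mathbb R^n)^{\otimes r}$ be a random tensor with independent (integrable) entries such that $\Pr(T_i\ne 0)\le n^{-1-\varepsilon}$ for all $i\in[n]^r$. Then $$\mathbb E\,\|T-\mathbb E T\|_{\mathrm{inj}}\le C\,\frac{r^5}{\varepsilon^2}\,\log^2\!\Big(\frac r\varepsilon\Big)\cdot\mathbb E\max_{i\in[n]^r}|T_i| .$$
   Context: $[n]=\{1,\dots,n\}$; $\log$ is the natural logarithm; $\mathbb E T$ is the entrywise expectation. The injective norm of $T\in(\mathbb R^n)^{\otimes r}$ is $\|T\|_{\mathrm{inj}}=\max\{|\langle T,x_1\otimes\cdots\otimes x_r\rangle| : x_1,\dots,x_r\in\mathbb R^n,\ \|x_1\|_2=\dots=\|x_r\|_2=1\}$, where $\langle T,X\rangle=\sum_{i\in[n]^r}T_iX_i$. *)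

(* Defs.v *)
From HB Require Import structures.
From mathcomp Require Import all_boot all_order all_algebra.
From mathcomp Require Import all_classical all_reals all_analysis.

Set Implicit Arguments.
Unset Strict Implicit.
Unset Printing Implicit Defensive.

Import Order.TTheory GRing.Theory Num.Theory.
Import numFieldNormedType.Exports.

Local Open Scope classical_set_scope.
Local Open Scope ring_scope.

(** Multi-indices [i \in [n]^r] are finite functions ['I_r -> 'I_n]; a tensor in
    [(R^n)^{\otimes r}] is the family of its entries. *)
Notation multi_index n r := {ffun 'I_r -> 'I_n}.

Definition tensor (R : realType) (n r : nat) := multi_index n r -> R.

Section Tensors.
Context {R : realType} {n r : nat}.
Implicit Types T X : tensor R n r.

(** The canonical norm [`|x|] on ['rV[R]_n] is the max norm, not the Euclidean one. *)
Definition norm2 (x : 'rV[R]_n) : R := Num.sqrt (\sum_(j < n) x 0 j ^+ 2).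

Definition pure_tensor (x : 'I_r -> 'rV[R]_n) : tensor R n r :=
  fun i => \prod_(k < r) x k 0 (i k).

Definition tensor_dot T X : R := \sum_(i : multi_index n r) T i * X i.

(** For [0 < n] the set below is nonempty and, being a continuous image of a
    product of unit spheres, compact: the supremum is then a maximum. *)
Definition inj_norm T : R :=
  sup [set `|tensor_dot T (pure_tensor x)| |
        x in [set x : 'I_r -> 'rV[R]_n | forall k, norm2 (x k) = 1]].

(** [0] is neutral for the maximum of the nonnegative reals [`|T i|]. *)
Definition max_entry T : R :=
  \big[Num.max/0]_(i : multi_index n r) `|T i|.

End Tensors.

Section RandomTensors.
Context {d : measure_display} {Omega : measurableType d} {R : realType}.
Variable P : probability Omega R.

Definition mutually_independent (I : finType) (X : I -> {RV P >-> R}) : Prop :=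
  forall (J : {set I}) (A : I -> set R),
    (forall i, measurable (A i)) ->
    P [set w | forall i, i \in J -> A i (X i w)] =
    (\prod_(i in J) P (X i @^-1` A i))%E.

Definition expected_tensor (n r : nat)
    (T : multi_index n r -> {RV P >-> R}) : tensor R n r :=
  fun i => fine ('E_P[T i])%E.

End RandomTensors.

(* Main.v *)
(** Discretising the entries reduces the statement to finite product spaces,
    where an expectation is a finite sum. Truncating at level [2 M], with
    [M] the expected maximum, costs at most [4 M], because independence makes a
    lone exceedance about as likely as any exceedance. So assume
    [`|X_i| <= 1] and [Pr(X_i <> 0) <= 1 / (n nu^4)] with [nu = n^(eps/4)].

    Rounding the test vectors to a grid of mesh [1 / (2 r n)] costs a factor
    [2]. For grid vectors put [w_i = prod_k x_k(i_k)], so that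
    [sum_i w_i^2 <= 1]. Suprema are controlled by
    [sup Z <= a + (1/lam) * sum exp (lam (Z - a))] and exponential moments.
    - Light entries, [|w_i| <= 1 / (n nu^2)]: a Bernstein bound beats the
      entropy of the grid thanks to the extra factor [nu^2].
    - Heavy entries with [x_k(i_k)^2 <= |w_i|] for some [k]: then
      [|w_i| <= prod_(l != k) x_l(i_l)^2], whose sum is at most the largest
      number of nonzero entries of [X] on a line in direction [k].
    - The other heavy entries: at the dyadic scale [t < |w_i| <= 2 t] all factors
      have [x_k(i_k)^2 > t], so only the coordinates above this level matter.
      The count at scale [t] is at most [O(1/t)] plus a multiple of the
      number of those coordinates; weighted by [t] and summed over [t], the
      latter gives [O(sum_k |x_k|^2)], and there are [O(log n)] scales. *)

Require Import Defs.
From HB Require Import structures.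
From mathcomp Require Import all_boot all_order all_algebra.
From mathcomp Require Import all_classical all_reals all_analysis.
From mathcomp Require Import measurable_realfun.
From mathcomp Require Import ring lra.
Import Order.TTheory GRing.Theory Num.Theory.
Import numFieldNormedType.Exports.

Local Open Scope classical_set_scope.
Local Open Scope ring_scope.

(** * Expectations under finite product measures, and truncation tails *)

Section FiniteProductExpectation.
Context {R : realType} {I V : finType} (q : I -> V -> R).

Definition prod_exp (g : {ffun I -> V} -> R) : R :=
  \sum_(w : {ffun I -> V}) (\prod_i q i (w i)) * g w.

Definition marg_exp (i : I) (f : V -> R) : R := \sum_v q i v * f v.

Lemma eq_prod_exp g h : g =1 h -> prod_exp g = prod_exp h.
Proof. by move=> gh; apply: eq_bigr => w _; rewrite gh. Qed.

Lemma prod_expD g h :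
  prod_exp (fun w => g w + h w) = prod_exp g + prod_exp h.
Proof. by rewrite -big_split; apply: eq_bigr => w _; rewrite mulrDr. Qed.

Lemma prod_expZ a g : prod_exp (fun w => a * g w) = a * prod_exp g.
Proof. by rewrite /prod_exp mulr_sumr; apply: eq_bigr => w _; rewrite mulrCA. Qed.

Lemma prod_exp_sum (J : finType) (Q : pred J) (g : J -> {ffun I -> V} -> R) :
  prod_exp (fun w => \sum_(j | Q j) g j w) = \sum_(j | Q j) prod_exp (g j).
Proof.
by rewrite exchange_big; apply: eq_bigr => w _; rewrite mulr_sumr.
Qed.

Lemma prod_exp_prod (f : I -> V -> R) :
  prod_exp (fun w => \prod_i f i (w i)) = \prod_i marg_exp i (f i).
Proof.
rewrite bigA_distr_bigA; apply: eq_bigr => w _; by rewrite -big_split.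
Qed.

Hypothesis q_ge0 : forall i v, 0 <= q i v.
Hypothesis q_sum1 : forall i, \sum_v q i v = 1.

Lemma le_prod_exp g h : (forall w, g w <= h w) -> prod_exp g <= prod_exp h.
Proof.
move=> gh; apply: ler_sum => w _; apply: ler_wpM2l => //.
by apply: prodr_ge0.
Qed.

Lemma marg_exp1 i : marg_exp i (fun=> 1) = 1.
Proof. by rewrite -[RHS](q_sum1 i); apply: eq_bigr => v _; rewrite mulr1. Qed.

Lemma prod_exp_cst a : prod_exp (fun=> a) = a.
Proof.
transitivity (a * prod_exp (fun w => \prod_(i : I) 1)).
  by rewrite -prod_expZ; apply: eq_prod_exp => w; rewrite big1 ?mulr1.
by rewrite (prod_exp_prod (fun _ _ => 1)) big1 ?mulr1// => i _; rewrite marg_exp1.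
Qed.

Lemma prod_exp_coord i (f : V -> R) :
  prod_exp (fun w => f (w i)) = marg_exp i f.
Proof.
transitivity (prod_exp (fun w => \prod_j (if j == i then f (w j) else 1))).
  apply: eq_prod_exp => w; rewrite (bigD1 i)//= eqxx big1 ?mulr1// => j.
  by move=> /negbTE ->.
rewrite (prod_exp_prod (fun j v => if j == i then f v else 1)) (bigD1 i)//= eqxx.
by rewrite big1 ?mulr1// => j /negbTE ->; rewrite marg_exp1.
Qed.

Lemma le_marg_exp i f g : (forall v, f v <= g v) -> marg_exp i f <= marg_exp i g.
Proof. by move=> fg; apply: ler_sum => v _; apply: ler_wpM2l. Qed.

Lemma marg_expD i f g : marg_exp i (fun v => f v + g v) = marg_exp i f + marg_exp i g.
Proof. by rewrite -big_split; apply: eq_bigr => v _; rewrite mulrDr. Qed.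

Lemma marg_expZ i a f : marg_exp i (fun v => a * f v) = a * marg_exp i f.
Proof. by rewrite /marg_exp mulr_sumr; apply: eq_bigr => v _; rewrite mulrCA. Qed.

Lemma marg_exp_ge0 i f : (forall v, 0 <= f v) -> 0 <= marg_exp i f.
Proof. by move=> f0; apply: sumr_ge0 => v _; apply: mulr_ge0. Qed.

Lemma ler_norm_marg_exp i f : `|marg_exp i f| <= marg_exp i (fun v => `|f v|).
Proof.
apply: le_trans (ler_norm_sum _ _ _) _; apply: ler_sum => v _.
by rewrite normrM ger0_norm.
Qed.

Section Truncation.
Variables (x : I -> V -> R) (u : R).
Let mx (w : {ffun I -> V}) : R := \big[Num.max/0]_i `|x i (w i)|.
Let ind (b : bool) : R := b%:R.

Let mx_ge i (w : {ffun I -> V}) : `|x i (w i)| <= mx w.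
Proof. by rewrite /mx; apply: le_bigmax. Qed.

Let mx_ge0 w : 0 <= mx w. Proof. exact: bigmax_ge_id. Qed.

(* At most one summand is nonzero. *)
Let lone_exceedance (w : {ffun I -> V}) : 0 <= u ->
  \sum_i `|x i (w i)| * ind (u < `|x i (w i)|) *
     \prod_(j | j != i) ind (`|x j (w j)| <= u) <= mx w.
Proof.
move=> u0; case: (pickP (fun i => u < `|x i (w i)|)) => [i hi|h]; last first.
  by rewrite big1// => i _; rewrite h /ind mulr0 mul0r.
rewrite (bigD1 i)//= [X in _ + X]big1 ?addr0 => [|j ji].
  apply: le_trans (mx_ge i w); rewrite /ind hi mulr1 ler_piMr//.
  by apply: prodr_ile1 => j _; rewrite ler0n lern1 leq_b1.
rewrite [X in _ * X](bigD1 i) 1?eq_sym//= leNgt hi /= /ind.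
by rewrite mul0r mulr0.
Qed.

(** By Markov's inequality, with probability at least 1/2 no entry exceeds [u]. By independence each
    tail expectation is then at most twice its part on the event that no other entry exceeds [u],
    and by [lone_exceedance] these parts sum to at most the expected maximum. *)
Lemma sum_tail_le :
  0 < u -> 2 * prod_exp mx <= u ->
  \sum_i marg_exp i (fun v => `|x i v| * (u < `|x i v|)%R%:R) <= 2 * prod_exp mx.
Proof.
move=> u0 Mu; have u0' := ltW u0.
pose t i := marg_exp i (fun v => `|x i v| * ind (u < `|x i v|)).
pose b i := marg_exp i (fun v => ind (`|x i v| <= u)).
have b01 i : 0 <= b i <= 1.
  rewrite marg_exp_ge0 => [|v]; last exact: ler0n.
  by rewrite -(marg_exp1 i) le_marg_exp// => v; rewrite /ind lern1 leq_b1.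
have t0 i : 0 <= t i.
  by apply: marg_exp_ge0 => v; rewrite mulr_ge0 // ler0n.
(* Markov's inequality: pointwise, [1 - mx w / u] is at most the indicator that no entry exceeds
   [u]. *)
have B : 1 - u^-1 * prod_exp mx <= \prod_i b i.
  rewrite -(prod_exp_prod (fun i v => ind (`|x i v| <= u))).
  have -> : 1 - u^-1 * prod_exp mx = prod_exp (fun w => 1 + (- u^-1) * mx w).
    by rewrite prod_expD prod_exp_cst prod_expZ mulNr.
  apply: le_prod_exp => w; case: (pickP (fun i => u < `|x i (w i)|)) => [i hi|h].
    have : 0 <= \prod_i0 ind (`|x i0 (w i0)| <= u) by apply: prodr_ge0 => j _; rewrite ler0n.
    apply: le_trans; rewrite mulNr subr_le0 mulrC ler_pdivlMr// mul1r.
    exact: le_trans (ltW hi) (mx_ge _ _).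
  rewrite big1 => [|i _]; last by rewrite leNgt h.
  by rewrite gerDl mulNr oppr_le0 mulr_ge0// invr_ge0.
have B2 : 1 / 2 <= \prod_i b i.
  apply: le_trans B; have : u^-1 * prod_exp mx <= 1 / 2.
    by rewrite mulrC ler_pdivrMr//; lra.
  lra.
have H : \sum_i t i * \prod_i b i <= prod_exp mx.
  apply: le_trans (le_prod_exp _ _ (fun w => lone_exceedance w u0')).
  rewrite prod_exp_sum; apply: ler_sum => i _.
  (* Each summand of [lone_exceedance] is a product of functions of single coordinates, so its
     expectation factorises. *)
  pose F j v := if j == i then `|x j v| * ind (u < `|x j v|) else ind (`|x j v| <= u).
  rewrite (_ : prod_exp _ = prod_exp (fun w => \prod_j F j (w j))); last first.
    apply: eq_prod_exp => w; rewrite [RHS](bigD1 i)//= {1}/F eqxx; congr (_ * _).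
    by apply: eq_bigr => j /negbTE ji; rewrite /F ji.
  rewrite prod_exp_prod (bigD1 i)//= [leRHS](bigD1 i)//=.
  rewrite (_ : marg_exp i (F i) = t i); last by rewrite /F eqxx.
  apply: ler_wpM2l => //; rewrite [leRHS](eq_bigr b) => [|j /negbTE ji]; last by rewrite /F ji.
  by rewrite ler_piMl ?prodr_ge0// => [j _|]; have /andP[] := b01 i => //; have /andP[] := b01 j.
rewrite -mulr_suml in H.
have : \sum_i t i * (1 / 2) <= prod_exp mx.
  by apply: le_trans H; rewrite -mulr_suml ler_wpM2l// sumr_ge0.
rewrite -mulr_suml /t /ind; lra.
Qed.

End Truncation.
End FiniteProductExpectation.

(** This is [1 + y <= expR y] for the single term [j]. The right-hand side does not depend on [j],
    so it bounds a supremum while its expectation is a sum of exponential moments. *)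
Lemma soft_max {R : realType} (J : finType) (Q : pred J) (Z : J -> R) (lam : R) :
  0 < lam -> forall j, Q j -> Z j <= lam^-1 * \sum_(k | Q k) expR (lam * Z k).
Proof.
move=> l0 j Qj; rewrite mulrC ler_pdivlMr// mulrC (bigD1 j)//=.
have := expR_ge1Dx (lam * Z j).
have : 0 <= \sum_(k | Q k && (k != j)) expR (lam * Z k).
  by apply: sumr_ge0 => k _; exact: expR_ge0.
lra.
Qed.

(** * Elementary properties of the injective norm *)

Section InjectiveNorm.
Context {R : realType} {n r : nat}.
Implicit Types (T S : tensor R n r) (x y : 'rV[R]_n) (z : 'I_r -> 'rV[R]_n).

Lemma norm2_ge0 x : 0 <= norm2 x. Proof. exact: sqrtr_ge0. Qed.

Lemma sqr_norm2 x : norm2 x ^+ 2 = \sum_j x 0 j ^+ 2.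
Proof. by rewrite sqr_sqrtr// sumr_ge0// => j _; rewrite sqr_ge0. Qed.

Lemma le_norm2 x (a : R) : 0 <= a -> \sum_j x 0 j ^+ 2 <= a ^+ 2 -> norm2 x <= a.
Proof. by move=> a0; rewrite -sqr_norm2 ler_pXn2r// nnegrE norm2_ge0. Qed.

Lemma ler_norm_norm2 x j : `|x 0 j| <= norm2 x.
Proof.
rewrite -(ler_pXn2r (n := 2))// ?nnegrE ?norm2_ge0// sqr_norm2 (bigD1 j)//= real_normK ?num_real//.
by rewrite lerDl sumr_ge0// => k _; rewrite sqr_ge0.
Qed.

Lemma norm2Z (a : R) x : norm2 (a *: x) = `|a| * norm2 x.
Proof.
rewrite /norm2 -sqrtr_sqr -sqrtrM ?sqr_ge0// mulr_sumr; congr Num.sqrt.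
by apply: eq_bigr => j _; rewrite mxE exprMn.
Qed.

Lemma tensor_dot_le_sum T z : (forall k, norm2 (z k) <= 1) ->
  `|tensor_dot T (pure_tensor z)| <= \sum_i `|T i|.
Proof.
move=> z1; apply: le_trans (ler_norm_sum _ _ _) _; apply: ler_sum => i _.
rewrite normrM ler_piMr// normr_prod; apply: prodr_ile1 => k _.
by rewrite normr_ge0 (le_trans (ler_norm_norm2 _ _)).
Qed.

Lemma inj_norm_has_ubound T :
  has_ubound [set `|tensor_dot T (pure_tensor z)| |
        z in [set z : 'I_r -> 'rV[R]_n | forall k, norm2 (z k) = 1]].
Proof.
exists (\sum_i `|T i|) => _ [z z1 <-]; apply: tensor_dot_le_sum => k.
by rewrite z1.
Qed.

Lemma tensor_dot_le_inj_norm T z : (forall k, norm2 (z k) = 1) ->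
  `|tensor_dot T (pure_tensor z)| <= inj_norm T.
Proof. by move=> z1; apply: (ub_le_sup (inj_norm_has_ubound T)); exists z. Qed.

Hypothesis n_gt0 : (0 < n)%N.

Lemma inj_norm_le T (B : R) :
  (forall z, (forall k, norm2 (z k) = 1) ->
     `|tensor_dot T (pure_tensor z)| <= B) ->
  inj_norm T <= B.
Proof.
move=> H; apply: ge_sup => [|_ [z z1 <-]]; last exact: H.
pose e : 'rV[R]_n := \row_j (j == Ordinal n_gt0)%:R.
exists `|tensor_dot T (pure_tensor (fun=> e))|; exists (fun=> e) => // k /=.
rewrite /norm2 (bigD1 (Ordinal n_gt0))//= mxE eqxx big1 => [|j /negbTE ji].
  by rewrite expr1n addr0 sqrtr1.
by rewrite mxE ji expr0n.
Qed.

Lemma inj_norm_ge0 T : 0 <= inj_norm T.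
Proof.
rewrite leNgt; apply/negP => h.
(* If the supremum were negative, no family of unit vectors could exist, so every upper bound would
   hold vacuously; this one contradicts the negativity. *)
have : inj_norm T <= 2 * inj_norm T.
  apply: inj_norm_le => z /(tensor_dot_le_inj_norm T) h'.
  by have := normr_ge0 (tensor_dot T (pure_tensor z)); lra.
lra.
Qed.

Lemma inj_norm_le_sum T : inj_norm T <= \sum_i `|T i|.
Proof.
by apply: inj_norm_le => z z1; apply: tensor_dot_le_sum => k; rewrite z1.
Qed.

Lemma tensor_dotD T S z :
  tensor_dot (fun i => T i + S i) (pure_tensor z) =
  tensor_dot T (pure_tensor z) + tensor_dot S (pure_tensor z).
Proof. by rewrite -big_split; apply: eq_bigr => i _; rewrite mulrDl. Qed.

Lemma ler_inj_normD T S :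
  inj_norm (fun i => T i + S i) <= inj_norm T + inj_norm S.
Proof.
apply: inj_norm_le => z z1; rewrite tensor_dotD.
by apply: le_trans (ler_normD _ _) _; apply: lerD; apply: tensor_dot_le_inj_norm.
Qed.

Lemma eq_inj_norm T S : T =1 S -> inj_norm T = inj_norm S.
Proof. by move=> /funext ->. Qed.

Lemma ler_inj_normZ T (a : R) :
  inj_norm (fun i => a * T i) <= `|a| * inj_norm T.
Proof.
apply: inj_norm_le => z z1.
rewrite (_ : tensor_dot _ _ = a * tensor_dot T (pure_tensor z)).
  by rewrite normrM ler_wpM2l// tensor_dot_le_inj_norm.
by rewrite [RHS]mulr_sumr; apply: eq_bigr => i _; rewrite mulrA.
Qed.

Lemma pure_tensorZ (a : 'I_r -> R) z i :
  pure_tensor (fun k => a k *: z k) i = (\prod_k a k) * pure_tensor z i.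
Proof. by rewrite -big_split; apply: eq_bigr => k _; rewrite mxE. Qed.

(** Homogeneity in each slot reduces to unit vectors; a zero vector, which cannot be normalised,
    makes the left side vanish. *)
Lemma tensor_dot_le T z :
  `|tensor_dot T (pure_tensor z)| <= inj_norm T * \prod_k norm2 (z k).
Proof.
have [/existsP[k /eqP k0]|] := boolP [exists k, norm2 (z k) == 0].
  rewrite [X in `|X| <= _]big1 ?normr0 ?mulr_ge0 ?inj_norm_ge0 ?prodr_ge0// => [j _|i _].
    exact: norm2_ge0.
  have := ler_norm_norm2 (z k) (i k); rewrite k0 normr_le0 => /eqP zk0.
  by rewrite /pure_tensor (bigD1 k)//= zk0 mul0r mulr0.
rewrite negb_exists => /forallP nz.
have nz0 k : 0 < norm2 (z k) by rewrite lt_neqAle norm2_ge0 eq_sym nz.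
pose z' k := (norm2 (z k))^-1 *: z k.
have z'1 k : norm2 (z' k) = 1.
  by rewrite norm2Z ger0_norm ?invr_ge0 ?norm2_ge0// mulVf.
rewrite (_ : tensor_dot T _ = tensor_dot T (pure_tensor z') * \prod_k norm2 (z k)).
  have p0 : 0 <= \prod_k norm2 (z k) by apply: prodr_ge0 => k _; exact: norm2_ge0.
  by rewrite normrM (ger0_norm p0) ler_wpM2r ?tensor_dot_le_inj_norm.
rewrite [RHS]mulr_suml; apply: eq_bigr => i _; rewrite -mulrA; congr (_ * _).
rewrite pure_tensorZ mulrAC -big_split/= big1 ?mul1r// => k _.
by rewrite mulVf.
Qed.

(* Replacing the [x k] by the [y k] one slot at a time. *)
Lemma tensor_dot_perturb T (x y : 'I_r -> 'rV[R]_n) (h : R) :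
  (forall k, norm2 (x k) <= 1) -> (forall k, norm2 (y k) <= 1) ->
  (forall k, norm2 (x k - y k) <= h) ->
  `|tensor_dot T (pure_tensor x) - tensor_dot T (pure_tensor y)| <=
    r%:R * h * inj_norm T.
Proof.
move=> x1 y1 xyh.
pose z (d : nat) (k : 'I_r) := if (k < d)%N then y k else x k.
suff H d : (d <= r)%N ->
    `|tensor_dot T (pure_tensor x) - tensor_dot T (pure_tensor (z d))| <=
      d%:R * h * inj_norm T.
  have := H r (leqnn r); rewrite (_ : pure_tensor (z r) = pure_tensor y)//.
  by congr pure_tensor; apply/funext => k; rewrite /z ltn_ord.
elim: d => [|d IH] dr.
  rewrite (_ : z 0%N = x) ?subrr ?normr0 ?mul0r//; exact/funext.
(* By linearity in slot [d], the value at [v] is the difference of the values at [z d] and [z d.+1];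
   all other slots have norm at most 1. *)
pose v k := if k == Ordinal dr then x k - y k else z d k.
have -> : tensor_dot T (pure_tensor x) - tensor_dot T (pure_tensor (z d.+1)) =
    (tensor_dot T (pure_tensor x) - tensor_dot T (pure_tensor (z d))) +
    tensor_dot T (pure_tensor v).
  suff -> : tensor_dot T (pure_tensor v) =
      tensor_dot T (pure_tensor (z d)) - tensor_dot T (pure_tensor (z d.+1)) by ring.
  rewrite /tensor_dot -sumrB; apply: eq_bigr => i _; rewrite -mulrBr; congr (_ * _).
  rewrite /pure_tensor (bigD1 (Ordinal dr))//= [X in _ = X - _](bigD1 (Ordinal dr))//=.
  rewrite [X in _ = _ - X](bigD1 (Ordinal dr))//=.
  rewrite [X in _ = _ - _ * X](eq_bigr (fun k => z d k 0 (i k))) => [|k kd].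
    rewrite -mulrBl /v /z eqxx ltnn ltnSn !mxE; congr (_ * _).
    by apply: eq_bigr => k /negbTE ->.
  by rewrite /z ltnS leq_eqVlt -val_eqE/= in kd *; rewrite (negbTE kd).
apply: le_trans (ler_normD _ _) _.
rewrite -addn1 natrD 2!mulrDl; apply: lerD; first exact: IH (ltnW dr).
apply: le_trans (tensor_dot_le _ _) _.
rewrite mulrC ler_wpM2r ?inj_norm_ge0// mul1r (bigD1 (Ordinal dr))//= /v eqxx.
apply: le_trans (xyh (Ordinal dr)); rewrite ler_piMr ?norm2_ge0//.
apply: prodr_ile1 => k /negbTE ->; by rewrite norm2_ge0 /z /=; case: (k < d)%N; rewrite ?x1 ?y1.
Qed.

End InjectiveNorm.

(** * Rounding test vectors to a finite grid *)

Section Net.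
Context {R : realType}.

(** For [0 < N] the indices encode the multiples of [1 / N] in [[-1, 1]]; index [N] stands for 0. *)
Definition grid_val (N : nat) (g : 'I_N.*2.+1) : R := (g%:R - N%:R) / N%:R.

(** Rounding goes towards 0, so that a rounded vector stays in the unit ball. *)
Lemma grid_round (N : nat) (a : R) : (0 < N)%N -> `|a| <= 1 ->
  exists g : 'I_N.*2.+1, `|grid_val N g| <= `|a| /\ `|a - grid_val N g| <= N%:R^-1.
Proof.
move=> N0 a1; have N0' : (0 : R) < N%:R by rewrite ltr0n.
have aN0 : 0 <= `|a| * N%:R by rewrite mulr_ge0.
pose m := Num.truncn (`|a| * N%:R).
have /andP[m1 m2] : m%:R <= `|a| * N%:R < m.+1%:R by apply: truncn_itv.
have mN : (m <= N)%N.
  by rewrite -(ler_nat R); apply: le_trans m1 _; rewrite ler_piMl.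
have m1' : m%:R / N%:R <= `|a| by rewrite ler_pdivrMr.
have m2' : `|a| <= m%:R / N%:R + N%:R^-1.
  by rewrite -[X in _ + X]mul1r -mulrDl natr1 ler_pdivlMr// ltW.
have mN0 : 0 <= m%:R / N%:R :> R by rewrite divr_ge0.
case: (leP 0 a) => a0.
  have h : (N + m < N.*2.+1)%N by rewrite ltnS -addnn leq_add2l.
  exists (Ordinal h); rewrite /grid_val/= natrD (addrC N%:R) addrK.
  rewrite (ger0_norm mN0); rewrite (ger0_norm a0) in m1' m2' *.
  by split=> //; rewrite ger0_norm; lra.
have h : (N - m < N.*2.+1)%N by rewrite ltnS -addnn (leq_trans (leq_subr _ _)) ?leq_addr.
exists (Ordinal h); rewrite /grid_val/= natrB// addrAC subrr add0r mulNr.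
rewrite normrN (ger0_norm mN0); rewrite (ltr0_norm a0) in m1' m2' *.
by split=> //; rewrite opprK ler0_norm; lra.
Qed.

(** Rounding changes the multilinear form by at most half of the injective norm itself, and this
    error is absorbed into the left side. *)
Lemma inj_norm_le_net (n r : nat) (T : tensor R n r) (B : R) :
  (0 < n)%N -> (0 < r)%N ->
  (forall y : {ffun 'I_r * 'I_n -> 'I_(2 * r * n).*2.+1},
     (forall k, \sum_j grid_val _ (y (k, j)) ^+ 2 <= 1) ->
     `|\sum_i T i * \prod_k grid_val _ (y (k, i k))| <= B) ->
  inj_norm T <= 2 * B.
Proof.
move=> n0 r0 H; set N := (2 * r * n)%N in H.
have N0 : (0 < N)%N by rewrite !muln_gt0 r0 n0.
have r0' : (0 : R) < r%:R by rewrite ltr0n.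
have n0' : (1 : R) <= n%:R by rewrite ler1n.
suff : inj_norm T <= B + inj_norm T / 2 by lra.
apply: inj_norm_le => // z z1.
have z1' k j : `|z k 0 j| <= 1 by rewrite -(z1 k) ler_norm_norm2.
have rd (kj : 'I_r * 'I_n) : {g : 'I_N.*2.+1 | `|grid_val N g| <= `|z kj.1 0 kj.2| /\
     `|z kj.1 0 kj.2 - grid_val N g| <= N%:R^-1}.
  exact: cid (grid_round N _ N0 (z1' kj.1 kj.2)).
pose y := [ffun kj => sval (rd kj)].
pose v k : 'rV[R]_n := \row_j grid_val N (y (k, j)).
have v1 k : \sum_j grid_val N (y (k, j)) ^+ 2 <= 1.
  rewrite -[leRHS](expr1n R 2) -[X in X ^+ 2](z1 k) sqr_norm2; apply: ler_sum => j _.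
  rewrite ffunE; case: (svalP (rd (k, j))) => /= h _.
  by rewrite -real_normK ?num_real// -[leRHS]real_normK ?num_real// lerXn2r// nnegrE.
have vn k : norm2 (v k) <= 1.
  apply: le_norm2 => //; rewrite expr1n; apply: le_trans (v1 k).
  by apply: ler_sum => j _; rewrite mxE.
(* There are [n] coordinates with error at most [1 / (2 r n)] each, hence a squared norm of at most
   [1 / ((2 r)^2 n)]. *)
have zv k : norm2 (z k - v k) <= (2 * r%:R)^-1.
  apply: le_norm2; first by rewrite invr_ge0 mulr_ge0// ltW.
  apply: (@le_trans _ _ (\sum_(j < n) (N%:R^-1) ^+ 2)).
    apply: ler_sum => j _; rewrite !mxE ffunE; case: (svalP (rd (k, j))) => /= _ h.
    by rewrite -real_normK ?num_real// lerXn2r// nnegrE.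
  have n0n : (n%:R : R) != 0 by rewrite pnatr_eq0 -lt0n.
  have r0n : (r%:R : R) != 0 by rewrite pnatr_eq0 -lt0n.
  rewrite sumr_const card_ord.
  have -> : (N%:R^-1 ^+ 2 *+ n : R) = (2 * r%:R)^-1 ^+ 2 * n%:R^-1.
    by rewrite /N !natrM -mulr_natr; field; rewrite r0n n0n.
  by rewrite ler_piMr ?sqr_ge0// invf_le1// (lt_le_trans ltr01).
have := tensor_dot_perturb n0 T z v _ (fun k => eq_ind_r (fun a => a <= 1) (lexx 1) (z1 k)) vn zv.
have -> : tensor_dot T (pure_tensor v) = \sum_i T i * \prod_k grid_val N (y (k, i k)).
  apply: eq_bigr => i _; congr (_ * _); apply: eq_bigr => k _; by rewrite mxE.
have := H y v1.
have -> : r%:R * (2 * r%:R)^-1 * inj_norm T = inj_norm T / 2.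
  by field; rewrite gt_eqF.
move: (tensor_dot T _) => A; move: (\sum_i _) => D.
move=> h1 h2; have : `|A| <= `|A - D| + `|D| by rewrite -{1}(subrK D A) ler_normD.
lra.
Qed.

End Net.

(** * Dyadic scales and geometric sums *)

Section DyadicScales.
Context {R : realType}.

Definition dyad (s : nat) : R := 2^-1 ^+ s.

Lemma dyad_gt0 s : 0 < dyad s. Proof. by rewrite exprn_gt0// invr_gt0. Qed.

Lemma dyad_le1 s : dyad s <= 1.
Proof. by rewrite exprn_ile1// ?invr_ge0// invf_le1// ler1n. Qed.

Lemma dyadS s : dyad s.+1 = 2^-1 * dyad s. Proof. exact: exprS. Qed.

Lemma sum_dyad_le2 m : \sum_(s < m) dyad s <= 2.
Proof.
suff : \sum_(s < m) dyad s = 2 - 2 * dyad m by have := dyad_gt0 m; lra.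
elim: m => [|m IH]; first by rewrite big_ord0 /dyad expr0; ring.
by rewrite big_ord_recr/= IH dyadS; field.
Qed.

(** A geometric sum is at most twice its largest term. In the induction, if [b <= 1] the term
    [s = 0] drops out and the rest is half of the sum for [2 * b]. *)
Lemma sum_dyad_lt m (b : R) : 0 <= b ->
  \sum_(s < m | dyad s < b) dyad s <= 2 * b.
Proof.
elim: m b => [|m IH] b b0; first by rewrite big_ord0 mulr_ge0.
have [b1|b1] := ltP 1 b.
  apply: le_trans (_ : 2 <= _); last lra.
  apply: le_trans (sum_dyad_le2 m.+1); rewrite [leRHS](bigID (fun s : 'I__ => dyad s < b))/=.
  by rewrite lerDl sumr_ge0// => s _; rewrite ltW ?dyad_gt0.
rewrite big_mkcond big_ord_recl -big_mkcond /= /dyad expr0 ltNge b1 /= add0r.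
have := IH (2 * b); rewrite mulr_ge0// => /(_ isT) h.
rewrite (eq_bigr (fun s : 'I_m => 2^-1 * dyad s)) => [|s _]; last exact: exprS.
rewrite (eq_bigl (fun s : 'I_m => dyad s < 2 * b)) => [|s]; last first.
  by rewrite -/(dyad _) /bump /= add1n dyadS mulrC ltr_pdivrMr// mulrC.
rewrite -mulr_sumr; lra.
Qed.

(** Take the first scale below [w]. It is not [s = 0] since [w <= 1], so the preceding scale exists
    and is at least [w]; it comes no later than [S] since [dyad S <= d < w]. *)
Lemma dyadic_scale (w d : R) S : d < w -> w <= 1 -> dyad S <= d ->
  exists s : 'I_S.+1, [/\ d / 2 < dyad s, dyad s < w & w <= 2 * dyad s].
Proof.
move=> dw w1 Sd.
have ex : exists s, dyad s < w by exists S; exact: le_lt_trans dw.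
case: (ex_minnP ex) => s sw smin.
have sS : (s < S.+1)%N by rewrite ltnS smin// (le_lt_trans Sd).
exists (Ordinal sS) => /=.
case: s sw smin sS => [|s] sw smin sS; first by move: sw; rewrite /dyad expr0; lra.
have ws : w <= dyad s by rewrite leNgt; apply/negP => /smin; rewrite ltnn.
by split=> //; rewrite dyadS; lra.
Qed.

End DyadicScales.

(** * Entries of rank-one tensors: counting and heavy sums *)

Section EntryProducts.
Context {R : realType} {n r : nat}.
Local Notation I := (multi_index n r).
Implicit Types (a : 'I_r -> 'I_n -> R) (i c : I) (k : 'I_r).

Definition entry_prod a i : R := \prod_k a k (i k).

Definition in_balls a := forall k, \sum_j a k j ^+ 2 <= 1.

Lemma sum_sqr_entry_prod a : \sum_i entry_prod a i ^+ 2 = \prod_k \sum_j a k j ^+ 2.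
Proof. by rewrite bigA_distr_bigA; apply: eq_bigr => i _; rewrite prodrXl. Qed.

Lemma sum_sqr_entry_prod_le1 a : in_balls a -> \sum_i entry_prod a i ^+ 2 <= 1.
Proof.
move=> a1; rewrite sum_sqr_entry_prod; apply: prodr_ile1 => k _.
by rewrite a1 sumr_ge0// => j _; rewrite sqr_ge0.
Qed.

Lemma entry_prod_le1 a i : in_balls a -> `|entry_prod a i| <= 1.
Proof.
move=> /sum_sqr_entry_prod_le1; rewrite (bigD1 i)//= => h.
have : `|entry_prod a i| ^+ 2 <= 1.
  rewrite real_normK ?num_real//; apply: le_trans h.
  by rewrite lerDl sumr_ge0// => j _; rewrite sqr_ge0.
by rewrite -[leRHS](expr1n R 2) ler_pXn2r// nnegrE.
Qed.

(** Chebyshev counting: the squares of the entries sum to at most 1. *)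
Lemma card_entry_prod_gt a (t : R) : in_balls a -> 0 < t ->
  #|[pred i | t < `|entry_prod a i|]|%:R <= t ^- 2.
Proof.
move=> /sum_sqr_entry_prod_le1 h t0; rewrite -[leRHS]mul1r ler_pdivlMr ?exprn_gt0//.
apply: le_trans h; rewrite -sum1_card natr_sum mulr_suml big_mkcond/=.
apply: ler_sum => i _; case: ifP => [|_]; last exact: sqr_ge0.
rewrite inE => ti; rewrite mul1r -[leRHS]real_normK ?num_real//.
by rewrite lerXn2r// ?nnegrE ltW.
Qed.

Variable o : 'I_n.

(** The nonempty fibres of [reset k] are the lines in direction [k], each represented by its point
    with [k]-th coordinate [o]. *)
Definition reset k i : I := [ffun l => if l == k then o else i l].

Lemma card_fibre k c : (#|[pred i | reset k i == c]| <= n)%N.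
Proof.
pose ev (i : I) : 'I_n := i k.
rewrite -[leqRHS]card_ord -(card_in_imset (f := ev)) ?max_card//.
move=> i j; rewrite !inE => /eqP ic /eqP jc ij; apply/ffunP => l.
have : reset k i l = reset k j l by rewrite ic jc.
by rewrite !ffunE; case: eqP => [->|].
Qed.

(* The factor at [k] being at most the product [b] of the others, the entry is
   at most [b ^+ 2], which is constant on the fibres in direction [k]. *)
Lemma sum_unbalanced_le a (xi : I -> R) (F : R) k :
  in_balls a -> 0 <= F -> (forall i, 0 <= xi i) ->
  (forall c, \sum_(i | reset k i == c) xi i <= F) ->
  \sum_(i : I | a k (i k) ^+ 2 <= `|entry_prod a i|) xi i * `|entry_prod a i| <= F.
Proof.
move=> a1 F0 xi0 hF.
pose b i := \prod_(l | l != k) a l (i l).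
have bE i : b (reset k i) = b i.
  by apply: eq_bigr => l /negbTE lk; rewrite ffunE lk.
have wE i : `|entry_prod a i| = `|a k (i k)| * `|b i|.
  by rewrite /entry_prod (bigD1 k)//= normrM.
have wb i : a k (i k) ^+ 2 <= `|entry_prod a i| -> `|entry_prod a i| <= b i ^+ 2.
  rewrite wE -real_normK ?num_real// -[b i ^+ 2]real_normK ?num_real//.
  have : 0 <= `|a k (i k)| by []; have : 0 <= `|b i| by [].
  move: `|a k (i k)| `|b i| => u v v0 u0 uv.
  have [->|un0] := eqVneq u 0; first by rewrite mul0r sqr_ge0.
  have {un0 u0}u0 : 0 < u by rewrite lt_neqAle eq_sym un0.
  by rewrite expr2 ler_pM2l// in uv; rewrite expr2 ler_wpM2r.
apply: (@le_trans _ _ (\sum_i xi i * b i ^+ 2)).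
  rewrite big_mkcond/=; apply: ler_sum => i _; case: ifP => [h|_].
    by rewrite ler_wpM2l// wb.
  by rewrite mulr_ge0// sqr_ge0.
rewrite (partition_big (reset k) xpredT)//=.
apply: (@le_trans _ _ (\sum_(c : I | c k == o) F * b c ^+ 2)).
  rewrite [leRHS]big_mkcond/=; apply: ler_sum => c _; case: ifP => [_|ck].
    rewrite (eq_bigr (fun i => xi i * b c ^+ 2)) => [|i /eqP <-]; last by rewrite bE.
    by rewrite -mulr_suml ler_wpM2r// sqr_ge0.
  rewrite big_pred0// => i; apply/negP => /eqP ic.
  by move: ck; rewrite -ic ffunE !eqxx.
rewrite -mulr_sumr ler_piMr//.
(* The restriction [c k = o] becomes the factor at slot [k] of a product, so the sum over [c]
   factorises into sums of at most 1. *)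
pose f l j : R := if l == k then (j == o)%:R else a l j ^+ 2.
rewrite (_ : \sum_(c : I | c k == o) _ = \sum_(c : I) \prod_l f l (c l)); last first.
  rewrite big_mkcond; apply: eq_bigr => c _; rewrite (bigD1 k)//= {1}/f eqxx.
  case: eqP => ck; last by rewrite mul0r.
  by rewrite mul1r -prodrXl; apply: eq_bigr => l /negbTE lk; rewrite /f lk.
rewrite -(bigA_distr_bigA f); apply: prodr_ile1 => l _; rewrite /f.
case: eqP => _; last by rewrite a1 sumr_ge0// => j _; rewrite sqr_ge0.
rewrite (bigD1 o)//= eqxx big1 ?addr0 ?ler01 ?lexx// => j /negbTE ->.
by [].
Qed.

Definition cutoff (t : R) a k j : R := if t < a k j ^+ 2 then a k j else 0.

(** Let [s] be the scale of a balanced entry. All its factors have squares above the entry, hence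
    above [dyad s], so the cutoff leaves the entry unchanged, and its weight is at most
    [2 * dyad s]. *)
Lemma sum_balanced_le a (xi : I -> R) (d : R) S :
  in_balls a -> (forall i, 0 <= xi i) -> 0 < d -> dyad S <= d ->
  \sum_(i | (d < `|entry_prod a i|) &&
            [forall k, `|entry_prod a i| < a k (i k) ^+ 2])
      xi i * `|entry_prod a i| <=
  \sum_(s < S.+1 | d / 2 < dyad s)
     2 * dyad s * \sum_(i | dyad s < `|entry_prod (cutoff (dyad s) a) i|) xi i.
Proof.
move=> a1 xi0 d0 Sd.
under [leRHS]eq_bigr do rewrite mulr_sumr.
under [leRHS]eq_bigr do rewrite big_mkcond.
rewrite exchange_big/= big_mkcond/=; apply: ler_sum => i _.
have term0 (s : 'I_S.+1) : 0 <= (if dyad s < `|entry_prod (cutoff (dyad s) a) i|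
    then 2 * dyad s * xi i else 0).
  by case: ifP => // _; rewrite !mulr_ge0// ltW// dyad_gt0.
case: ifP => [/andP[dw /forallP bal]|_]; last exact: sumr_ge0.
have [s [ds sw ws]] := dyadic_scale _ _ _ dw (entry_prod_le1 _ _ a1) Sd.
rewrite (bigD1 s)//=.
have -> : entry_prod (cutoff (dyad s) a) i = entry_prod a i.
  by apply: eq_bigr => k _; rewrite /cutoff (lt_trans sw).
rewrite sw mulrC -[leLHS]addr0 lerD ?sumr_ge0//.
by rewrite ler_wpM2r.
Qed.

(** An entry that is not balanced has a direction [k] in which it is unbalanced, and is charged to
    it; the [r] directions cost [F] each. *)
Lemma sum_heavy_le a (xi : I -> R) (F d : R) S :
  in_balls a -> (forall i, 0 <= xi i) -> 0 < d -> dyad S <= d -> 0 <= F ->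
  (forall k c, \sum_(i | reset k i == c) xi i <= F) ->
  \sum_(i | d < `|entry_prod a i|) xi i * `|entry_prod a i| <=
  r%:R * F + \sum_(s < S.+1 | d / 2 < dyad s)
     2 * dyad s * \sum_(i | dyad s < `|entry_prod (cutoff (dyad s) a) i|) xi i.
Proof.
move=> a1 xi0 d0 Sd F0 hF.
rewrite (bigID (fun i : I => [forall k, `|entry_prod a i| < a k (i k) ^+ 2]))/= addrC.
apply: lerD; last exact: sum_balanced_le.
apply: (@le_trans _ _ (\sum_k
    \sum_(i : I | a k (i k) ^+ 2 <= `|entry_prod a i|) xi i * `|entry_prod a i|)).
  under [leRHS]eq_bigr do rewrite big_mkcond.
  rewrite exchange_big/= big_mkcond/=; apply: ler_sum => i _.
  have t0 k : 0 <= (if a k (i k) ^+ 2 <= `|entry_prod a i| then xi i * `|entry_prod a i| else 0).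
    by case: ifP => // _; rewrite mulr_ge0.
  case: ifP => [/andP[_]|_]; last exact: sumr_ge0.
  rewrite negb_forall => /existsP[k]; rewrite -leNgt => hk.
  by rewrite (bigD1 k)//= hk lerDl sumr_ge0.
apply: (@le_trans _ _ (\sum_(k < r) F)).
  by apply: ler_sum => k _; apply: sum_unbalanced_le.
by rewrite sumr_const card_ord mulr_natl.
Qed.

End EntryProducts.

(** * Exponential moments and uniform deviation bounds *)

Section ExponentialMoments.
Context {R : realType} {I V : finType} (q : I -> V -> R).
Hypothesis q_ge0 : forall i v, 0 <= q i v.
Hypothesis q_sum1 : forall i, \sum_v q i v = 1.
Local Notation Ex := (prod_exp q).

(** A union bound in expectation form: [Psi] is the soft maximum of the excesses [Z j - a j]. The
    level [a j] may vary with [j], so that more complex indices can be given more room. *)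
Lemma uniform_bound_of_mgf (J : finType) (Q : pred J)
    (Z : J -> {ffun I -> V} -> R) (a D : J -> R) (lam E : R) :
  0 < lam -> (forall j, Q j -> Ex (fun w => expR (lam * Z j w)) <= expR (D j)) ->
  \sum_(j | Q j) expR (D j - lam * a j) <= E ->
  exists Psi : {ffun I -> V} -> R, [/\ forall w, 0 <= Psi w,
    forall j w, Q j -> Z j w <= a j + Psi w & Ex Psi <= E / lam].
Proof.
move=> l0 hD hE.
exists (fun w => lam^-1 * \sum_(j | Q j) expR (lam * (Z j w - a j))); split.
- move=> w; apply: mulr_ge0; first by rewrite invr_ge0 ltW.
  by apply: sumr_ge0 => j _; exact: expR_ge0.
- move=> j w Qj; rewrite addrC -lerBlDr.
  exact: (soft_max _ Q (fun j => Z j w - a j) _ l0).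
rewrite prod_expZ mulrC ler_wpM2r ?invr_ge0 ?(ltW l0)//; apply: le_trans hE.
rewrite prod_exp_sum; apply: ler_sum => j Qj.
rewrite (_ : Ex _ = expR (- (lam * a j)) * Ex (fun w => expR (lam * Z j w))).
  by rewrite expRD mulrC ler_wpM2r ?expR_ge0// hD.
rewrite -prod_expZ; apply: eq_prod_exp => w; rewrite -expRD; congr expR; ring.
Qed.

Variables (x : I -> V -> R) (p : R).
Hypothesis x_le1 : forall i v, `|x i v| <= 1.
Hypothesis x_sparse : forall i, marg_exp q i (fun v => (x i v != 0)%:R) <= p.

(** For an indicator [b] one has [expR (lam b) <= 1 + expR lam * b], so each factor is at most
    [1 + p * expR lam]. *)
Lemma mgf_count (S : pred I) (lam : R) : 0 <= lam ->
  Ex (fun w => expR (lam * \sum_(i | S i) (x i (w i) != 0)%:R)) <=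
  expR (#|S|%:R * (p * expR lam)).
Proof.
move=> l0.
rewrite (_ : Ex _ = Ex (fun w => \prod_i
    (if S i then expR (lam * (x i (w i) != 0)%:R) else 1))); last first.
  by apply: eq_prod_exp => w; rewrite mulr_sumr expR_sum big_mkcond.
rewrite (prod_exp_prod q (fun i v => if S i then expR (lam * (x i v != 0)%:R) else 1)).
have -> : expR (#|S|%:R * (p * expR lam)) =
    \prod_i (if S i then expR (p * expR lam) else 1).
  by rewrite -big_mkcond/= prodr_const expRM_natl.
apply: ler_prod => i _; rewrite marg_exp_ge0//=; last first.
  by move=> v; case: ifP => // _; rewrite expR_ge0.
case: ifP => Si; last by rewrite marg_exp1.
apply: le_trans (expR_ge1Dx _).
apply: (@le_trans _ _ (marg_exp q i (fun v => 1 + expR lam * (x i v != 0)%:R))).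
  apply: le_marg_exp => // v; case: (x i v != 0).
    by rewrite !mulr1 lerDr.
  by rewrite !mulr0 expR0 addr0.
rewrite marg_expD marg_expZ marg_exp1// lerD2l mulrC.
by rewrite ler_wpM2r// expR_ge0.
Qed.

(** From [1 - y <= expR (- y)] one gets [expR y * (1 - y) <= 1], while [(1 + y + 2 y^2) (1 - y) = 1
    + y^2 (1 - 2 y)] is at least 1. *)
Lemma expR_le_quadratic (y : R) : y <= 1 / 2 -> expR y <= 1 + y + 2 * y ^+ 2.
Proof.
move=> y2; have h := expR_ge1Dx (- y).
have e0 : 0 < expR y by exact: expR_gt0.
have : expR y * (1 - y) <= 1.
  by rewrite -[leRHS](mulfV (lt0r_neq0 e0)) -expRN ler_pM2l.
have y0 : 0 <= y ^+ 2 by exact: sqr_ge0.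
move=> h2; have : expR y * (1 - y) <= (1 + y + 2 * y ^+ 2) * (1 - y) by nra.
by rewrite ler_pM2r//; lra.
Qed.

(** Bernstein's argument: centring cancels the linear term of the quadratic bound, and the second
    moment is at most [p] because [x^2] is at most the indicator of [x != 0]. *)
Lemma mgf_centered (c : I -> R) : (forall i, `|c i| <= 1 / 2) ->
  Ex (fun w => expR (\sum_i c i * (x i (w i) - marg_exp q i (x i)))) <=
  expR (2 * p * \sum_i c i ^+ 2).
Proof.
move=> c2; under eq_prod_exp do rewrite expR_sum.
rewrite (prod_exp_prod q (fun i v => expR (c i * (x i v - marg_exp q i (x i))))).
rewrite mulr_sumr expR_sum; apply: ler_prod => i _.
rewrite marg_exp_ge0//=.
set m := marg_exp q i (x i).
have c0 : 0 <= 2 * c i ^+ 2 by rewrite mulr_ge0// sqr_ge0.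
rewrite (_ : marg_exp _ _ _ = expR (- (c i * m)) * marg_exp q i (fun v => expR (c i * x i v))).
  rewrite (_ : 2 * p * _ = - (c i * m) + (c i * m + 2 * c i ^+ 2 * p)); last by ring.
  rewrite expRD ler_wpM2l ?expR_ge0//; apply: le_trans (expR_ge1Dx _).
  apply: (@le_trans _ _ (marg_exp q i (fun v => 1 +
      (c i * x i v + 2 * c i ^+ 2 * (x i v != 0)%:R)))).
    apply: le_marg_exp => // v; apply: le_trans (expR_le_quadratic _ _) _.
      apply: le_trans (ler_norm _) _; rewrite normrM; apply: le_trans (c2 i).
      by rewrite ler_piMr.
    rewrite -addrA lerD2l lerD2l exprMn mulrA ler_wpM2l//.
    have [->|_] := eqVneq (x i v) 0; first by rewrite expr0n.
    by rewrite -real_normK ?num_real// exprn_ile1.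
  rewrite !marg_expD !marg_expZ marg_exp1// lerD2l lerD2l ler_wpM2l//.
rewrite -marg_expZ; apply: eq_bigr => v _; rewrite -expRD; congr (_ * expR _); ring.
Qed.

End ExponentialMoments.

(** * Sparse tensors with entries bounded by 1 *)

Section SparseBoundedTensor.
Context {R : realType} {n r : nat} {V : finType}.
Local Notation I := (multi_index n r).
Context (q : I -> V -> R).
Hypothesis q_ge0 : forall i v, 0 <= q i v.
Hypothesis q_sum1 : forall i, \sum_v q i v = 1.
Local Notation Ex := (prod_exp q).
Hypotheses (n_gt1 : (1 < n)%N) (r_gt0 : (0 < r)%N).
Variables (x : I -> V -> R) (nu : R).
Hypothesis nu_gt1 : 1 < nu.
Hypothesis x_le1 : forall i v, `|x i v| <= 1.
Local Notation p := ((n%:R * nu ^+ 4)^-1).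
Hypothesis x_sparse : forall i, marg_exp q i (fun v => (x i v != 0)%:R) <= p.

(* Threshold between the light entries, controlled by an exponential moment,
   and the heavy ones, controlled by counting. *)
Local Notation d := ((n%:R * nu ^+ 2)^-1).
Local Notation L := (ln nu).
Local Notation N := (2 * r * n)%N.
Local Notation G := {ffun 'I_r * 'I_n -> 'I_N.*2.+1}.
Local Notation m i := (marg_exp q i (x i)).
Local Notation xi i v := ((x i v != 0)%:R : R).

Let coef (y : G) (k : 'I_r) (j : 'I_n) : R := grid_val N (y (k, j)).
Let W (y : G) : I -> R := entry_prod (coef y).
Let ok (y : G) : bool := [forall k, \sum_j coef y k j ^+ 2 <= 1].

Let okP y : ok y -> in_balls (coef y). Proof. by move=> /forallP h k; exact: h. Qed.

Let n0 : 0 < n%:R :> R. Proof. by rewrite ltr0n (ltnW n_gt1). Qed.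
Let nu0 : 0 < nu. Proof. exact: lt_trans nu_gt1. Qed.
Let L0 : 0 < L. Proof. by rewrite ln_gt0. Qed.
Let expL : expR L = nu. Proof. by rewrite lnK// posrE. Qed.
Let N0 : (0 < N)%N. Proof. by rewrite !muln_gt0 r_gt0 (ltnW n_gt1). Qed.
Let d0 : 0 < d. Proof. by rewrite invr_gt0 mulr_gt0// exprn_gt0. Qed.
Let p0 : 0 < p. Proof. by rewrite invr_gt0 mulr_gt0// exprn_gt0. Qed.
Let nuX k : 1 <= nu ^+ k. Proof. by rewrite exprn_ege1// ltW. Qed.

(** This is [1 / (2 d)], the largest parameter for which light weights times [lam] stay within the
    range 1/2 of [mgf_centered]. *)
Let lam := n%:R * nu ^+ 2 / 2.
(** Solves [n / 2 - lam * a_light = - r n ln (2 N + 1)], which cancels the number of grid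
    vectors. *)
Let a_light : R := (1 + 2 * r%:R * ln (N.*2.+1%:R)) / nu ^+ 2.

(** The exponent of [mgf_centered] is at most [2 p lam^2 = n / 2]. The union runs over grid vectors
    and signs, so the remainder is at most [2 / lam <= 4]. *)
Lemma light_uniform : exists Psi : {ffun I -> V} -> R,
  [/\ forall w, 0 <= Psi w,
      forall y (w : {ffun I -> V}), ok y ->
        `|\sum_(i | `|W y i| <= d) (x i (w i) - m i) * W y i| <= a_light + Psi w
    & Ex Psi <= 4].
Proof.
have lam0 : 0 < lam by rewrite divr_gt0// mulr_gt0// exprn_gt0.
pose c0 y i := if `|W y i| <= d then W y i else 0.
(* The boolean is a sign, which turns one-sided bounds into a bound on the absolute value. *)
pose Z (yb : G * bool) (w : {ffun I -> V}) : R :=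
  \sum_i ((-1) ^+ yb.2 * c0 yb.1 i) * (x i (w i) - m i).
have c0d y i : `|c0 y i| <= d by rewrite /c0; case: ifP => // _; rewrite normr0 ltW.
have mgf (yb : G * bool) : ok yb.1 ->
    Ex (fun w => expR (lam * Z yb w)) <= expR (n%:R / 2).
  case: yb => y b /= oky.
  pose c i := lam * ((-1) ^+ b * c0 y i).
  rewrite (_ : Ex _ = Ex (fun w => expR (\sum_i c i * (x i (w i) - m i)))); last first.
    apply: eq_prod_exp => w; rewrite mulr_sumr; congr expR.
    by apply: eq_bigr => i _; rewrite mulrA.
  apply: le_trans (mgf_centered q q_ge0 q_sum1 x p x_le1 x_sparse c _) _.
    move=> i; rewrite /c normrM (gtr0_norm lam0) normrM normr_sign !mul1r.
    apply: le_trans (ler_wpM2l (ltW lam0) (c0d y i)) _.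
    rewrite le_eqVlt; apply/orP; left; apply/eqP; rewrite /lam.
    by field; rewrite !gt_eqF ?exprn_gt0.
  rewrite ler_expR.
  have h : \sum_i c i ^+ 2 <= lam ^+ 2.
    rewrite (eq_bigr (fun i => lam ^+ 2 * c0 y i ^+ 2)) => [|i _]; last first.
      by rewrite /c !exprMn sqrr_sign mul1r.
    rewrite -mulr_sumr ler_piMr ?sqr_ge0//.
    apply: le_trans (sum_sqr_entry_prod_le1 _ (okP _ oky)); apply: ler_sum => i _.
    by rewrite /c0; case: ifP => // _; rewrite expr0n sqr_ge0.
  apply: le_trans (ler_wpM2l _ h) _; first by rewrite mulr_ge0// ltW.
  by rewrite le_eqVlt; apply/orP; left; apply/eqP; rewrite /lam; field; rewrite !gt_eqF ?exprn_gt0.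
have [|Psi [Psi0 hPsi EPsi]] := uniform_bound_of_mgf q _ (fun yb : G * bool => ok yb.1) Z
  (fun=> a_light) (fun=> n%:R / 2) lam 2 lam0 mgf.
  have -> : n%:R / 2 - lam * a_light = - ((r * n)%:R * ln (N.*2.+1%:R)).
    by rewrite /lam /a_light natrM; field; rewrite gt_eqF.
  apply: (@le_trans _ _ (\sum_(yb : G * bool) expR (- ((r * n)%:R * ln (N.*2.+1%:R))))).
    by rewrite big_mkcond/=; apply: ler_sum => yb _; case: ifP => // _; rewrite expR_ge0.
  rewrite sumr_const card_prod card_bool card_ffun card_prod !card_ord.
  rewrite expRN expRM_natl lnK ?posrE ?ltr0n//.
  by rewrite -[leLHS]mulr_natl natrM natrX mulrAC mulfV ?mul1r// expf_neq0// pnatr_eq0.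
exists Psi; split => //.
  move=> y w oky; rewrite big_mkcond/= (_ : \sum_i _ = Z (y, false) w); last first.
    apply: eq_bigr => i _; rewrite /c0 /= expr0 mul1r; case: ifP => _.
      by rewrite mulrC.
    by rewrite mul0r.
  rewrite ler_norml; apply/andP; split; last exact: (hPsi (y, false)).
  rewrite lerNl (_ : - _ = Z (y, true) w); first exact: (hPsi (y, true)).
  rewrite /Z /= -sumrN; apply: eq_bigr => i _.
  by rewrite expr0 expr1 mul1r mulN1r mulNr.
apply: le_trans EPsi _; rewrite ler_pdivrMr// /lam.
have n1 : 1 <= n%:R :> R by rewrite ler1n ltnW.
have := nuX 2; nra.
Qed.

(** Solves [1 - L * a_fibre = - ln (r n^r)], which cancels the number of pairs [(k, c)]. *)
Let a_fibre : R := (1 + ln ((r * n ^ r)%:R)) / L.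

(** A line has at most [n] entries, so with parameter [L], where [expR L = nu], the exponent in
    [mgf_count] is at most [n p nu = nu^-3 <= 1]. *)
Lemma fibre_uniform (o : 'I_n) : exists Phi : {ffun I -> V} -> R,
  [/\ forall w, 0 <= Phi w,
      forall k c (w : {ffun I -> V}), \sum_(i | reset o k i == c) xi i (w i) <= a_fibre + Phi w
    & Ex Phi <= 1 / L].
Proof.
pose Z (kc : 'I_r * I) (w : {ffun I -> V}) := \sum_(i | reset o kc.1 i == kc.2) xi i (w i).
have mgf (kc : 'I_r * I) : true -> Ex (fun w => expR (L * Z kc w)) <= expR 1.
  move=> _; apply: le_trans (mgf_count q q_ge0 q_sum1 x p x_sparse _ L (ltW L0)) _.
  rewrite ler_expR expL.
  have h := card_fibre o kc.1 kc.2; rewrite -(ler_nat R) in h.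
  apply: le_trans (ler_wpM2r _ h) _; first by rewrite mulr_ge0// ltW.
  have -> : n%:R * (p * nu) = (nu ^+ 3)^-1 by field; rewrite !gt_eqF.
  by rewrite invf_le1 ?exprn_gt0.
have rn0 : (0 < r * n ^ r)%N by rewrite muln_gt0 r_gt0 expn_gt0 (ltnW n_gt1).
have [|Phi [Phi0 hPhi EPhi]] := uniform_bound_of_mgf q _ xpredT Z
  (fun=> a_fibre) (fun=> 1) L 1 L0 mgf.
  have -> : 1 - L * a_fibre = - ln ((r * n ^ r)%:R).
    by rewrite /a_fibre; field; rewrite gt_eqF.
  rewrite sumr_const card_prod card_ffun !card_ord expRN lnK ?posrE ?ltr0n//.
  by rewrite -[leLHS]mulr_natl mulfV// pnatr_eq0 -lt0n.
by exists Phi; split => // k c w; exact: (hPhi (k, c)).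
Qed.

(** The price of one nonzero grid coordinate: [expR (- L K) = 1 / (2 N r n)]. *)
Let K : R := ln ((2 * N * (r * n))%:R) / L.
Let supp_size (y : G) : R := \sum_kj (grid_val N (y kj) != 0 :> R)%:R.

Lemma grid_val_eq0 (g : 'I_N.*2.+1) : (grid_val N g == 0 :> R) = (g == N :> nat).
Proof.
by rewrite mulf_eq0 invr_eq0 pnatr_eq0 (gtn_eqF N0) orbF subr_eq0 eqr_nat.
Qed.

(** The sum factorises over the [r n] coordinates. The [2 N] nonzero grid values add [1 / (r n)] to
    each factor, and [(1 + 1 / (r n))^(r n) <= e]. Thus the union bound charges a vector for its
    support only. *)
Lemma sum_expR_supp_size : \sum_y expR (- (L * (K * supp_size y))) <= expR 1.
Proof.
have rn0 : (0 < r * n)%N by rewrite muln_gt0 r_gt0 (ltnW n_gt1).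
have A0 : (0 < 2 * N * (r * n))%N by rewrite 2!muln_gt0 N0 rn0.
pose ka : R := ((2 * N * (r * n))%:R)^-1.
pose f (g : 'I_N.*2.+1) : R := if grid_val N g == 0 :> R then 1 else ka.
rewrite (_ : \sum_y _ = \sum_(y : G) \prod_kj f (y kj)); last first.
  apply: eq_bigr => y _; rewrite mulrA -mulrN /supp_size -sumrN mulr_sumr expR_sum.
  apply: eq_bigr => kj _; rewrite /f; case: eqP => _ /=.
    by rewrite oppr0 mulr0 expR0.
  rewrite mulrN1 expRN /K mulrC divfK ?gt_eqF// lnK//.
  by rewrite posrE ltr0n.
rewrite -(bigA_distr_bigA (fun=> f)) prodr_const card_prod !card_ord.
have -> : \sum_g f g = 1 + (r * n)%:R^-1.
  have h : (N < N.*2.+1)%N by rewrite ltnS -addnn leq_addr.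
  rewrite (bigD1 (Ordinal h))//= /f grid_val_eq0 eqxx; congr (_ + _).
  rewrite (eq_bigr (fun=> ka)) => [|g gN]; last first.
    by rewrite grid_val_eq0; move: gN; rewrite -val_eqE/= => /negbTE ->.
  rewrite sumr_const cardC1 card_ord /= -[LHS]mulr_natl /ka -mul2n.
  rewrite (natrM _ (2 * N) (r * n)) invfM mulrA mulfV ?mul1r//.
  by rewrite pnatr_eq0 -lt0n muln_gt0 N0.
have -> : expR 1 = expR (r * n)%:R^-1 ^+ (r * n) :> R.
  by rewrite -expRM_natl mulfV// pnatr_eq0 -lt0n.
rewrite lerXn2r ?nnegrE ?expR_ge0// ?expR_ge1Dx//.
Qed.

(** At most [t^-2] entries exceed [t], so the exponent in [mgf_count] is at most
    [t^-2 p nu <= 2 / t], because [n nu^2 t >= 1/2]. *)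
Lemma level_uniform (t : R) : 0 < t -> t <= 1 -> d / 2 < t ->
  exists Y : {ffun I -> V} -> R,
  [/\ forall w, 0 <= Y w,
      forall y (w : {ffun I -> V}), ok y ->
        \sum_(i | t < `|W y i|) xi i (w i) <=
        3 / (t * L) + K * supp_size y + Y w
    & Ex Y <= 1 / L].
Proof.
move=> t0 t1 dt.
pose Z (y : G) (w : {ffun I -> V}) := \sum_(i | t < `|W y i|) xi i (w i).
have mgf y : ok y -> Ex (fun w => expR (L * Z y w)) <= expR (2 / t).
  move=> oky; apply: le_trans (mgf_count q q_ge0 q_sum1 x p x_sparse _ L (ltW L0)) _.
  rewrite ler_expR expL.
  apply: le_trans (ler_wpM2r _ (card_entry_prod_gt _ _ (okP _ oky) t0)) _.
    by rewrite mulr_ge0// ltW.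
  have -> : t ^- 2 * (p * nu) = (n%:R * nu ^+ 3 * t)^-1 / t.
    by field; rewrite !gt_eqF.
  rewrite ler_wpM2r ?invr_ge0 ?(ltW t0)//.
  rewrite -[leRHS]invrK lef_pV2 ?posrE ?invr_gt0// ?mulr_gt0 ?exprn_gt0//.
  have : 2^-1 <= n%:R * nu ^+ 2 * t.
    have h : d / 2 * (n%:R * nu ^+ 2) = 2^-1 by field; rewrite !gt_eqF.
    by rewrite -h mulrC ler_pM2l ?mulr_gt0 ?exprn_gt0// ltW.
  move=> /le_trans; apply; rewrite ler_wpM2r ?(ltW t0)// ler_wpM2l ?(ltW n0)//.
  by rewrite (exprS nu 2) ler_peMl ?exprn_ge0 ?ltW.
(* The level has 3 where the moment has 2: the spare [expR (- 1 / t)] pays for the factor [e] of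
   [sum_expR_supp_size], as [t <= 1]. *)
have [|Y [Y0 hY EY]] := uniform_bound_of_mgf q _ ok Z
  (fun y => 3 / (t * L) + K * supp_size y) (fun=> 2 / t) L 1 L0 mgf; last by exists Y.
apply: (@le_trans _ _ (\sum_y expR (- t^-1) * expR (- (L * (K * supp_size y))))).
  rewrite big_mkcond/=; apply: ler_sum => y _; case: ifP => _; last first.
    by rewrite mulr_ge0// expR_ge0.
  rewrite -expRD ler_expR le_eqVlt; apply/orP; left; apply/eqP.
  by field; rewrite !gt_eqF.
rewrite -mulr_sumr; apply: le_trans (ler_wpM2l (expR_ge0 _) sum_expR_supp_size) _.
rewrite -expRD -[leRHS]expR0 ler_expR.
have : 1 <= t^-1 by rewrite invf_ge1.
lra.
Qed.

(** Since 0 is a grid value, the cut-off vector is again a grid vector, to which [level_uniform]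
    applies with a smaller support. *)
Lemma exists_cutoff (t : R) y : 0 <= t -> ok y -> exists y' : G,
  [/\ ok y', coef y' = cutoff t (coef y)
    & supp_size y' <= \sum_kj (t < coef y kj.1 kj.2 ^+ 2)%R%:R].
Proof.
move=> t0 oky.
have h : (N < N.*2.+1)%N by rewrite ltnS -addnn leq_addr.
have g0 : grid_val N (Ordinal h) = 0 :> R by apply/eqP; rewrite grid_val_eq0.
pose y' : G := [ffun kj => if t < coef y kj.1 kj.2 ^+ 2 then y kj else Ordinal h].
have y'E : coef y' = cutoff t (coef y).
  apply/funext => k; apply/funext => j; rewrite /coef ffunE /cutoff /=.
  by case: ifP.
exists y'; split=> //.
  apply/forallP => k; apply: le_trans (okP _ oky k); apply: ler_sum => j _.
  rewrite y'E /cutoff; case: ifP => // _; by rewrite expr0n sqr_ge0.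
apply: ler_sum => kj _; rewrite ffunE; case: ifP => _; last by rewrite g0 eqxx.
by rewrite lern1 leq_b1.
Qed.

Lemma inj_norm_sparse_le (S : nat) : dyad S <= d ->
  Ex (fun w => inj_norm (fun i => x i (w i) - m i)) <=
  2 * (a_light + 4 + 1 + r%:R * (a_fibre + 1 / L) + 6 * S.+1%:R / L
       + 4 * r%:R * K + 4 / L).
Proof.
move=> Sd; have n_gt0 := ltnW n_gt1; pose o := Ordinal n_gt0.
have [Psi [Psi0 hPsi EPsi]] := light_uniform.
have [Phi [Phi0 hPhi EPhi]] := fibre_uniform o.
(* Scales outside the range get the dummy value 0, so that choice yields one family [Y] indexed by
   all [s]. *)
have lev (s : nat) : exists Y : {ffun I -> V} -> R, d / 2 < dyad s ->
  [/\ forall w, 0 <= Y w,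
      forall y (w : {ffun I -> V}), ok y ->
        \sum_(i | dyad s < `|W y i|) xi i (w i) <=
        3 / (dyad s * L) + K * supp_size y + Y w
    & Ex Y <= 1 / L].
  case: (ltP (d / 2) (dyad s)) => [h|_]; last by exists (fun=> 0).
  by have [Y hY] := level_uniform _ (dyad_gt0 s) (dyad_le1 s) h; exists Y.
have {lev}[Y hY] := boolp.choice lev.
have K0 : 0 <= K.
  rewrite divr_ge0 ?(ltW L0)// ln_ge0// ler1n.
  by rewrite 2!muln_gt0 N0 muln_gt0 r_gt0 n_gt0.
have r0 : 0 <= r%:R :> R by [].
(* In order: light entries, means of the heavy entries, unbalanced heavy entries, and the dyadic
   scales of the balanced ones. *)
pose B w := a_light + Psi w + 1 + (r%:R * (a_fibre + Phi w) +
  (6 * S.+1%:R / L + 4 * r%:R * K + \sum_(s < S.+1 | d / 2 < dyad s) 2 * dyad s * Y s w)).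
apply: (@le_trans _ _ (Ex (fun w => 2 * B w))); last first.
  rewrite prod_expZ ler_wpM2l// /B !prod_expD ?prod_expZ ?prod_expD !(prod_exp_cst q q_sum1).
  have aux (A P F Q X X' Z l l' : R) : P <= 4 -> Q <= l -> Z <= l' ->
      A + P + 1 + (r%:R * (F + Q) + (X + X' + Z)) <= A + 4 + 1 + r%:R * (F + l) + X + X' + l'.
    move=> P4 Ql Zl; have : r%:R * (F + Q) <= r%:R * (F + l) by rewrite ler_wpM2l// lerD2l.
    lra.
  apply: aux => //.
  rewrite prod_exp_sum.
  apply: (@le_trans _ _ (\sum_(s < S.+1) 2 * dyad s * (1 / L))).
    rewrite big_mkcond; apply: ler_sum => s _; case: ifP => [/hY[_ _ h]|_].
      by rewrite prod_expZ ler_wpM2l// mulr_ge0// ltW// dyad_gt0.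
    by rewrite !mulr_ge0// ?invr_ge0 ltW// dyad_gt0.
  rewrite -mulr_suml -mulr_sumr mul1r ler_wpM2r ?invr_ge0 ?(ltW L0)//.
  have := @sum_dyad_le2 R S.+1; lra.
apply: le_prod_exp => // w; apply: inj_norm_le_net => // y oky'.
have oky : ok y by apply/forallP.
have oy := okP _ oky.
have -> : \sum_i (x i (w i) - m i) * \prod_k grid_val N (y (k, i k)) =
    \sum_(i | `|W y i| <= d) (x i (w i) - m i) * W y i +
    \sum_(i | d < `|W y i|) (x i (w i) - m i) * W y i.
  rewrite (bigID (fun i => `|W y i| <= d))/=; congr (_ + _).
  by apply: eq_bigl => i; rewrite ltNge.
apply: le_trans (ler_normD _ _) _; rewrite /B -addrA; apply: lerD; first exact: hPsi.
(* On heavy entries the cancellation from centring is given up: [|x - m|] is at most the indicator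
   of [x != 0] plus [p]. *)
apply: (@le_trans _ _ (\sum_(i | d < `|W y i|) p * `|W y i| +
                       \sum_(i | d < `|W y i|) xi i (w i) * `|W y i|)).
  rewrite -big_split/=; apply: le_trans (ler_norm_sum _ _ _) _; apply: ler_sum => i _.
  rewrite normrM -mulrDl ler_wpM2r// [leRHS]addrC; apply: le_trans (ler_normB _ _) _.
  have xx v : `|x i v| <= xi i v.
    by case: (eqVneq (x i v) 0) => [->|_]; rewrite ?normr0.
  apply: lerD => //; apply: le_trans (ler_norm_marg_exp q q_ge0 _ _) _.
  by apply: le_trans (x_sparse i); apply: le_marg_exp.
apply: lerD.
  (* Heaviness gives [|W| <= W^2 / d], and the squares sum to at most 1, so the means contribute at
     most [p / d = nu^-2]. *)
  apply: (@le_trans _ _ (\sum_i p / d * W y i ^+ 2)).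
    rewrite big_mkcond/=; apply: ler_sum => i _; case: ifP => [h|_]; last first.
      by rewrite mulr_ge0 ?sqr_ge0// divr_ge0 ?(ltW d0) ?(ltW p0).
    rewrite -mulrA ler_pM2l// -[W y i ^+ 2]real_normK ?num_real//.
    rewrite [`|W y i| ^+ 2]expr2 mulrA ler_peMl//.
    by rewrite mulrC ler_pdivlMr// mul1r ltW.
  rewrite -mulr_sumr; apply: le_trans (ler_wpM2l _ (sum_sqr_entry_prod_le1 _ oy)) _.
    by rewrite divr_ge0 ?(ltW d0) ?(ltW p0).
  have -> : p / d * 1 = (nu ^+ 2)^-1 by field; rewrite !gt_eqF.
  by rewrite invf_le1 ?exprn_gt0.
have F0 : 0 <= a_fibre + Phi w.
  by apply: le_trans (hPhi (Ordinal r_gt0) [ffun=> o] w); apply: sumr_ge0.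
apply: le_trans (sum_heavy_le o _ (fun i => xi i (w i)) _ _ _ oy _ d0 Sd F0
  (fun k c => hPhi k c w)) _ => //.
rewrite lerD2l.
apply: (@le_trans _ _ (\sum_(s < S.+1 | d / 2 < dyad s) (6 / L +
   2 * K * \sum_kj (if dyad s < coef y kj.1 kj.2 ^+ 2 then dyad s else 0) + 2 * dyad s * Y s w))).
  apply: ler_sum => s ds; have [_ h _] := hY s ds.
  have t0 : 0 < dyad s :> R by exact: dyad_gt0.
  (* Applying the level bound to the cut-off vector makes its support term count only the
     coordinates above the level. *)
  have [y' [oky2 y'E y'l]] := exists_cutoff _ _ (ltW t0) oky.
  have := h y' w oky2; rewrite /W y'E => h1.
  have {}h1 := le_trans h1 (lerD (lerD (lexx _) (ler_wpM2l K0 y'l)) (lexx _)).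
  have t2 : 0 <= 2 * dyad s :> R by rewrite mulr_ge0// ltW.
  apply: le_trans (ler_wpM2l t2 h1) _; rewrite 2!mulrDr.
  rewrite le_eqVlt; apply/orP; left; apply/eqP; congr (_ + _ + _).
    by field; rewrite !gt_eqF.
  rewrite (_ : \sum_kj (if _ then _ else _) =
      dyad s * \sum_kj (dyad s < coef y kj.1 kj.2 ^+ 2)%R%:R).
    ring.
  rewrite mulr_sumr; apply: eq_bigr => kj _; case: ifP => _; by rewrite ?mulr1 ?mulr0.
rewrite 2!big_split/=; apply: lerD => //; apply: lerD.
  apply: (@le_trans _ _ (\sum_(s < S.+1) 6 / L)).
    by rewrite big_mkcond/=; apply: ler_sum => s _; case: ifP => // _; rewrite divr_ge0 ?(ltW L0).
  rewrite sumr_const card_ord -mulr_natl le_eqVlt; apply/orP; left; apply/eqP; ring.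
rewrite -mulr_sumr.
(* After exchanging the sums, the scales below the square of a coordinate sum to at most twice that
   square, and all the squares sum to at most [r]. *)
suff h : (\sum_(s < S.+1 | d / 2 < dyad s)
    \sum_kj (if dyad s < coef y kj.1 kj.2 ^+ 2 then dyad s else 0 : R)) <= 2 * r%:R.
  rewrite (_ : 4 * r%:R * K = 2 * K * (2 * r%:R)); last by ring.
  by rewrite ler_wpM2l// mulr_ge0.
apply: (@le_trans _ _ (\sum_(s < S.+1)
    \sum_kj (if dyad s < coef y kj.1 kj.2 ^+ 2 then dyad s else 0))).
  rewrite big_mkcond/=; apply: ler_sum => s _.
  have h : 0 <= \sum_kj (if dyad s < coef y kj.1 kj.2 ^+ 2 then dyad s else 0) :> R.
    by apply: sumr_ge0 => kj _; case: ifP => // _; rewrite ltW// dyad_gt0.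
  by case: ifP.
rewrite exchange_big/=.
apply: (@le_trans _ _ (\sum_(kj : 'I_r * 'I_n) 2 * coef y kj.1 kj.2 ^+ 2)).
  by apply: ler_sum => kj _; rewrite -big_mkcond/=; apply: sum_dyad_lt; rewrite sqr_ge0.
rewrite -mulr_sumr ler_wpM2l//.
rewrite -(pair_big xpredT xpredT (fun k j => coef y k j ^+ 2))/=.
apply: (@le_trans _ _ (\sum_(k < r) 1)); first by apply: ler_sum => k _; exact: oy.
by rewrite sumr_const card_ord.
Qed.

End SparseBoundedTensor.

(** * Numerical constants *)

Section Constants.
Context {R : realType}.

Lemma ln2_ge_half : 1 / 2 <= ln 2 :> R.
Proof.
have h : ln (2^-1) <= - 2^-1 :> R.
  rewrite [X in ln X](_ : _ = 1 + - 2^-1); last by field.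
  by apply: le_ln1Dx; lra.
by rewrite lnV ?posrE// in h; lra.
Qed.

Lemma ln_le_id (y : R) : 0 < y -> ln y <= y.
Proof.
move=> y0; have -> : y = 1 + (y - 1) by ring.
by apply: le_trans (le_ln1Dx _) _; lra.
Qed.

(** As [L = eps / 4 * ln n], dividing by [L] costs [4 / eps] and cancels the [ln n] of each
    logarithm; [ln n >= 1/2] controls the remaining terms. *)
Lemma sparse_constant_le (n r : nat) (eps : R) : (1 < n)%N -> (0 < r)%N ->
  0 < eps -> eps < 1 ->
  forall (nu L : R) (S : nat),
  nu = n%:R `^ (eps / 4) -> L = ln nu -> S = (2 * up_log 2 n)%N ->
  2 * ((1 + 2 * r%:R * ln ((2 * r * n).*2.+1%:R)) / nu ^+ 2 + 4 + 1
       + r%:R * ((1 + ln ((r * n ^ r)%:R)) / L + 1 / L) + 6 * S.+1%:R / L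
       + 4 * r%:R * (ln ((2 * (2 * r * n) * (r * n))%:R) / L) + 4 / L)
  <= 1000 * r%:R ^+ 3 / eps.
Proof.
move=> n1 r0 e0 e1 nu L S nuE Lnu SE.
have n0 : (0 < n)%N by exact: ltnW.
have n0' : 0 < n%:R :> R by rewrite ltr0n.
have r0' : 0 < r%:R :> R by rewrite ltr0n.
have r1 : 1 <= r%:R :> R by rewrite ler1n.
set l := ln (n%:R : R).
have l2 : 1 / 2 <= l.
  by apply: le_trans ln2_ge_half _; rewrite ler_ln ?posrE// ler_nat.
have LE : L = eps / 4 * l by rewrite Lnu nuE ln_powR.
have L0 : 0 < L by rewrite LE mulr_gt0// ?divr_gt0//; lra.
have nu1 : 1 <= nu.
  by rewrite nuE -[leLHS](powRr0 n%:R) ler_powR// ?ler1n// divr_ge0// ltW.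
have {}Lnu : L <= nu by rewrite Lnu ln_le_id// (lt_le_trans ltr01).
have nu2 : nu <= nu ^+ 2 by rewrite expr2 ler_peMl// (le_trans ler01).
have iL (c : R) : c / L = 4 / eps * (c / l).
  rewrite LE; field; apply/andP; split; rewrite gt_eqF//; lra.
have il : 1 / l <= 2 by rewrite ler_pdivrMr; lra.
have il0 : 0 <= 1 / l by rewrite divr_ge0//; lra.
have ll : l / l = 1 by rewrite mulfV// gt_eqF//; lra.
have dvl (c e : R) : 0 <= c -> (c + e * l) / l <= 2 * c + e.
  move=> c0; rewrite mulrDl -mulrA ll mulr1 lerD2r mulrC -[l^-1]mul1r.
  by rewrite ler_wpM2r.
have t1 : (1 + 2 * r%:R * ln ((2 * r * n).*2.+1%:R)) / nu ^+ 2 <=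
    1 + 10 * r%:R ^+ 2 + 8 * r%:R / eps.
  have h : ln ((2 * r * n).*2.+1%:R) <= 5 * r%:R + l.
    apply: (@le_trans _ _ (ln ((5 * r)%:R * n%:R))).
      rewrite ler_ln ?posrE ?mulr_gt0 ?ltr0n ?muln_gt0 ?r0// -natrM ler_nat.
      rewrite -mul2n !mulnA -addn1 (_ : 5 * r * n = 2 * 2 * r * n + r * n)%N.
        by rewrite leq_add2l muln_gt0 r0.
      by rewrite [(5 * r)%N]mulSn mulnDl addnC.
    rewrite lnM ?posrE ?ltr0n ?muln_gt0 ?r0// lerD2r.
    apply: le_trans (ln_le_id _ _) _; rewrite ?ltr0n ?muln_gt0 ?r0//.
    by rewrite natrM.
  have i2 : l / nu ^+ 2 <= 4 / eps.
    rewrite ler_pdivrMr ?exprn_gt0 ?(lt_le_trans ltr01)//.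
    have -> : l = 4 / eps * L by rewrite LE; field; rewrite gt_eqF.
    by rewrite ler_wpM2l ?divr_ge0 ?(ltW e0)// (le_trans Lnu).
  have i1 : (nu ^+ 2)^-1 <= 1.
    by rewrite invf_le1 ?exprn_ege1// exprn_gt0// (lt_le_trans ltr01).
  (* The light term is not divided by [L]; its [ln n = (4 / eps) L] was absorbed in [i2] through
     [L <= nu <= nu^2]. *)
  have i0 : 0 <= (nu ^+ 2)^-1 by rewrite invr_ge0 sqr_ge0.
  apply: (@le_trans _ _ ((1 + 2 * r%:R * (5 * r%:R + l)) / nu ^+ 2)).
    by rewrite ler_wpM2r// lerD2l ler_wpM2l// mulr_ge0// ltW.
  have -> : (1 + 2 * r%:R * (5 * r%:R + l)) / nu ^+ 2 =
     (1 + 10 * r%:R ^+ 2) * (nu ^+ 2)^-1 + 2 * r%:R * (l / nu ^+ 2) by ring.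
  apply: lerD; last first.
    apply: le_trans (ler_wpM2l _ i2) _; first by rewrite mulr_ge0// ltW.
    by rewrite le_eqVlt; apply/orP; left; apply/eqP; ring.
  by rewrite ler_piMr// addr_ge0// mulr_ge0// sqr_ge0.
have t2 : (1 + ln ((r * n ^ r)%:R)) / L <= 4 / eps * (2 * (1 + r%:R) + r%:R).
  rewrite iL ler_wpM2l ?divr_ge0 ?(ltW e0)//.
  have -> : ln ((r * n ^ r)%:R) = ln r%:R + r%:R * l.
    by rewrite natrM natrX lnM ?posrE ?exprn_gt0// lnXn// mulr_natl.
  rewrite addrA; apply: le_trans (dvl _ _ _) _.
    by rewrite addr_ge0// ln_ge0.
  by rewrite lerD2r ler_wpM2l// lerD2l ln_le_id.
have t3 : S.+1%:R / L <= 4 / eps * 10.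
  rewrite iL ler_wpM2l ?divr_ge0 ?(ltW e0)//.
  have up : (up_log 2 n)%:R <= 1 + 2 * l.
    have [u0|u0] := posnP (up_log 2 n); first by rewrite u0; lra.
    have : (2 ^ (up_log 2 n).-1 <= n)%N.
      by rewrite ltnW//; have /andP[] := up_log_bounds (isT : (1 < 2)%N) n1.
    rewrite -(ler_nat R) natrX -ler_ln ?posrE ?exprn_gt0// lnXn// -/l.
    rewrite -[leLHS]mulr_natl => h.
    have : (up_log 2 n).-1%:R * (1 / 2) <= (up_log 2 n).-1%:R * ln 2 :> R.
      by rewrite ler_wpM2l// ln2_ge_half.
    have -> : (up_log 2 n)%:R = (up_log 2 n).-1%:R + 1 :> R by rewrite natr1 prednK.
    lra.
  have -> : S.+1%:R = 2 * (up_log 2 n)%:R + 1 :> R by rewrite SE -natr1 natrM.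
  apply: (@le_trans _ _ ((3 + 4 * l) / l)).
    rewrite ler_wpM2r ?invr_ge0//; lra.
  by apply: le_trans (dvl _ _ _) _; lra.
have t4 : ln ((2 * (2 * r * n) * (r * n))%:R) / L <= 4 / eps * (8 * r%:R ^+ 2 + 2).
  rewrite iL ler_wpM2l ?divr_ge0 ?(ltW e0)//.
  have -> : (2 * (2 * r * n) * (r * n))%:R = (4 * r%:R ^+ 2) * n%:R ^+ 2 :> R.
    by rewrite !natrM; ring.
  have r4 : 0 < 4 * r%:R ^+ 2 :> R by rewrite mulr_gt0// exprn_gt0.
  rewrite lnM ?posrE ?exprn_gt0// lnXn// -[X in _ + X]mulr_natl.
  apply: le_trans (dvl _ _ _) _.
    rewrite ln_ge0//; have : 1 <= r%:R ^+ 2 :> R by rewrite exprn_ege1.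
    lra.
  have := ln_le_id _ r4; lra.
have t5 (c : R) : 0 <= c -> c / L <= 4 / eps * (2 * c).
  move=> c0; rewrite iL ler_wpM2l ?divr_ge0 ?(ltW e0)//.
  by have := dvl c 0 c0; rewrite mul0r !addr0.
have ie : 1 <= 1 / eps by rewrite ler_pdivlMr// mul1r ltW.
apply: (@le_trans _ _ (2 * ((1 + 10 * r%:R ^+ 2 + 8 * r%:R / eps) + 4 + 1
   + r%:R * (4 / eps * (2 * (1 + r%:R) + r%:R) + 4 / eps * 2) + 6 * (4 / eps * 10)
   + 4 * r%:R * (4 / eps * (8 * r%:R ^+ 2 + 2)) + 4 / eps * 8))).
  rewrite ler_wpM2l//; apply: lerD; last by apply: le_trans (t5 4 _) _ => //; lra.
  apply: lerD; last by rewrite ler_wpM2l// mulr_ge0// ltW.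
  apply: lerD; last by rewrite -mulrA ler_wpM2l.
  apply: lerD; last first.
    apply: ler_wpM2l; first exact: ltW.
    by apply: lerD => //; have := t5 1 ler01; rewrite mulr1.
  by rewrite 2!lerD2r.
rewrite mul1r in ie; set E := eps^-1 in ie *.
set a : R := r%:R in r1 *.
have a2 : a <= a ^+ 2 by rewrite expr2 ler_peMl// (le_trans ler01).
have a3 : a ^+ 2 <= a ^+ 3 by rewrite (exprS _ 2) ler_peMl// sqr_ge0.
(* With [1 <= E] and all powers of [a] at most [a^3], the coefficients add up to 968. *)
rewrite [leLHS](_ : _ = 12 + 20 * a ^+ 2 +
    E * (16 * a + 32 * a + 24 * a ^+ 2 + 480 + 256 * a ^+ 3 + 64 * a + 64)); last by ring.
have h1 : 12 + 20 * a ^+ 2 <= E * (12 + 20 * a ^+ 2).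
  by rewrite ler_peMl//; lra.
apply: (le_trans (lerD h1 (lexx _))); rewrite -mulrDr.
rewrite [leRHS]mulrC ler_wpM2l; lra.
Qed.

End Constants.

(** * The bounded case in terms of [eps] *)

Section SparseBoundedTheorem.
Context {R : realType} {n r : nat} {V : finType}.
Local Notation I := (multi_index n r).
Context (q : I -> V -> R).
Hypothesis q_ge0 : forall i v, 0 <= q i v.
Hypothesis q_sum1 : forall i, \sum_v q i v = 1.
Hypotheses (n_gt0 : (0 < n)%N) (r_gt0 : (0 < r)%N).
Variables (x : I -> V -> R) (eps : R).
Hypotheses (eps_gt0 : 0 < eps) (eps_lt1 : eps < 1).
Hypothesis x_sparse :
  forall i, marg_exp q i (fun v => (x i v != 0)%:R) <= n%:R `^ (- 1 - eps).

Lemma exp_inj_norm_le1 : (forall i v, `|x i v| <= 1) ->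
  prod_exp q (fun w => inj_norm (fun i => x i (w i) - marg_exp q i (x i))) <=
  1000 * r%:R ^+ 3 / eps.
Proof.
move=> x_le1.
have r1 : 1 <= r%:R :> R by rewrite ler1n.
move: n_gt0; rewrite leq_eqVlt => /orP[/eqP n1|n_gt1].
  (* For [n = 1] the parameter [ln nu] would vanish; but there is a single entry, and once centred
     it is at most 2. *)
  apply: (@le_trans _ _ 2); last first.
    rewrite ler_pdivlMr//; have : 1 <= r%:R ^+ 3 :> R by rewrite exprn_ege1.
    move: eps_lt1; lra.
  rewrite -[leRHS](prod_exp_cst q q_sum1); apply: le_prod_exp => // w.
  apply: le_trans (inj_norm_le_sum n_gt0 _) _.
  apply: (@le_trans _ _ (\sum_(i : I) 2)); last first.
    by rewrite sumr_const card_ffun !card_ord -n1 exp1n.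
  apply: ler_sum => i _; apply: le_trans (ler_normB _ _) _.
  have h : `|marg_exp q i (x i)| <= 1.
    apply: le_trans (ler_norm_marg_exp q q_ge0 _ _) _.
    by rewrite -[leRHS](marg_exp1 q q_sum1 i) le_marg_exp.
  have := x_le1 i (w i); lra.
pose nu := n%:R `^ (eps / 4) : R.
have n0 : 0 < n%:R :> R by rewrite ltr0n.
have nn0 : n%:R != 0 :> R by rewrite gt_eqF.
have nuX k : nu ^+ k = n%:R `^ (eps / 4 * k%:R).
  by rewrite /nu -powR_mulrn ?powR_ge0// -powRrM.
have nu_gt1 : 1 < nu.
  by rewrite /nu /powR (negbTE nn0) -[ltLHS]expR0 ltr_expR mulr_gt0 ?divr_gt0// ln_gt0// ltr1n.
have pE : n%:R `^ (- 1 - eps) = (n%:R * nu ^+ 4)^-1.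
  rewrite nuX divfK// -{2}[n%:R]powRr1// -powRD ?nn0 ?implybT// -powRN.
  by congr (_ `^ _); ring.
have sp i : marg_exp q i (fun v => (x i v != 0)%:R) <= (n%:R * nu ^+ 4)^-1.
  by rewrite -pE.
apply: le_trans (sparse_constant_le n r eps n_gt1 r_gt0 eps_gt0 eps_lt1 _ _ _ erefl erefl erefl).
apply: (inj_norm_sparse_le q q_ge0 q_sum1 n_gt1 r_gt0 x nu nu_gt1 x_le1 sp).
have nu0 : 0 < nu by exact: lt_trans nu_gt1.
rewrite /dyad exprVn lef_pV2 ?posrE ?mulr_gt0 ?exprn_gt0//.
(* The last scale is fine enough: [2^S >= n^2 >= n nu^2], since [nu^2 = n^(eps/2) <= n]. *)
apply: (@le_trans _ _ (n%:R ^+ 2)).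
  rewrite [leRHS]expr2 ler_pM2l// nuX ler1_powR ?ler1n//.
  move: eps_lt1; lra.
by rewrite mul2n -addnn exprD expr2 -natrX ler_pM ?ler_nat ?up_logP.
Qed.

End SparseBoundedTheorem.

(** * Removing the bound on the entries by truncation *)

Lemma truncation_limit {R : realType} (A m k : R) : 0 <= m -> 1000 <= k ->
  (forall u, 0 < u -> 2 * m <= u -> A <= k * u + 4 * m) ->
  A <= 2004 / 1000 * k * m.
Proof.
move=> m0 k1 H; apply/ler_addgt0Pr => e e0.
have k0 : 0 < k by lra.
have ek : 0 < e / k by rewrite divr_gt0.
(* Adding [e / k] keeps the level positive even when [m = 0]; then [4 m <= (4 / 1000) k m] gives the
   factor [2 + 4 / 1000]. *)
have := H (2 * m + e / k); rewrite mulrDr [k * (e / k)]mulrC divfK ?gt_eqF// => h.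
apply: le_trans (h _ _) _; [lra|lra|].
have : 1000 * m <= k * m by rewrite ler_wpM2r.
lra.
Qed.

Section SparseFiniteTheorem.
Context {R : realType} {n r : nat} {V : finType}.
Local Notation I := (multi_index n r).
Context (q : I -> V -> R).
Hypothesis q_ge0 : forall i v, 0 <= q i v.
Hypothesis q_sum1 : forall i, \sum_v q i v = 1.
Hypotheses (n_gt0 : (0 < n)%N) (r_gt0 : (0 < r)%N).
Variables (x : I -> V -> R) (eps : R).
Hypotheses (eps_gt0 : 0 < eps) (eps_lt1 : eps < 1).
Hypothesis x_sparse :
  forall i, marg_exp q i (fun v => (x i v != 0)%:R) <= n%:R `^ (- 1 - eps).
Local Notation M := (prod_exp q (fun w => max_entry (fun i => x i (w i)))).

(** Write [x = u * x1 + x2], where [x1] is bounded by 1 and as sparse as [x]. The injective norm of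
    the centred [x2] is at most its entrywise sum, in which [x2] and its mean cost [2 M] each by
    [sum_tail_le]. *)
Lemma exp_inj_norm_truncate (u : R) : 0 < u -> 2 * M <= u ->
  prod_exp q (fun w => inj_norm (fun i => x i (w i) - marg_exp q i (x i))) <=
  1000 * r%:R ^+ 3 / eps * u + 4 * M.
Proof.
move=> u0 Mu.
pose x1 i v := if `|x i v| <= u then x i v / u else 0.
pose x2 i v := x i v * (u < `|x i v|)%R%:R.
have xE i v : x i v = u * x1 i v + x2 i v.
  rewrite /x1 /x2 leNgt; case: ltP => _ /=.
    by rewrite mulr0 add0r mulr1.
  by rewrite mulr0 addr0 mulrC divfK// gt_eqF.
have mE i : marg_exp q i (x i) = u * marg_exp q i (x1 i) + marg_exp q i (x2 i).
  by rewrite -marg_expZ -marg_expD; apply: eq_bigr => v _; rewrite xE.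
have x1_le1 i v : `|x1 i v| <= 1.
  rewrite /x1; case: ifP => h; last by rewrite normr0.
  by rewrite normrM normfV (gtr0_norm u0) ler_pdivrMr// mul1r.
have x1_sparse i : marg_exp q i (fun v => (x1 i v != 0)%:R) <= n%:R `^ (- 1 - eps).
  apply: le_trans (x_sparse i); apply: le_marg_exp => // v; rewrite ler_nat.
  case: (eqVneq (x i v) 0) => [x0|_]; last exact: leq_b1.
  by rewrite /x1 x0 mul0r; case: ifP; rewrite eqxx.
have tail : \sum_i marg_exp q i (fun v => `|x2 i v|) <= 2 * M.
  apply: le_trans (sum_tail_le q q_ge0 q_sum1 x u u0 Mu).
  apply: ler_sum => i _; apply: le_marg_exp => // v.
  by rewrite /x2 normrM (ger0_norm (ler0n _ _)).
apply: (@le_trans _ _ (prod_exp q (fun w =>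
    u * inj_norm (fun i => x1 i (w i) - marg_exp q i (x1 i)) +
    \sum_i (`|x2 i (w i)| + marg_exp q i (fun v => `|x2 i v|))))).
  apply: le_prod_exp => // w.
  rewrite (eq_inj_norm _ (fun i => u * (x1 i (w i) - marg_exp q i (x1 i)) +
      (x2 i (w i) - marg_exp q i (x2 i)))) => [|i]; last by rewrite mE xE; ring.
  apply: le_trans (ler_inj_normD n_gt0 _ _) _; apply: lerD.
    by apply: le_trans (ler_inj_normZ n_gt0 _ _) _; rewrite gtr0_norm.
  apply: le_trans (inj_norm_le_sum n_gt0 _) _; apply: ler_sum => i _.
  apply: le_trans (ler_normB _ _) _; rewrite lerD2l.
  exact: ler_norm_marg_exp.
rewrite prod_expD prod_expZ; apply: lerD.
  rewrite mulrC ler_wpM2r ?(ltW u0)//.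
  exact: exp_inj_norm_le1.
rewrite prod_exp_sum; under eq_bigr => i _.
  rewrite prod_expD (prod_exp_coord q q_sum1 i (fun v => `|x2 i v|)).
  rewrite (prod_exp_cst q q_sum1); over.
rewrite big_split/= (_ : 4 * M = 2 * M + 2 * M) ?lerD//.
by rewrite -mulrDl; congr (_ * _); ring.
Qed.

Lemma exp_inj_norm_finite :
  prod_exp q (fun w => inj_norm (fun i => x i (w i) - marg_exp q i (x i))) <=
  2004 * r%:R ^+ 3 / eps * M.
Proof.
have -> : 2004 * r%:R ^+ 3 / eps = 2004 / 1000 * (1000 * r%:R ^+ 3 / eps).
  by field; rewrite gt_eqF.
apply: truncation_limit; last exact: exp_inj_norm_truncate.
  rewrite -[leLHS](prod_exp_cst q q_sum1); apply: le_prod_exp => // w.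
  exact: bigmax_ge_id.
have r1 : 1 <= r%:R ^+ 3 :> R by rewrite exprn_ege1// ler1n.
by rewrite ler_pdivlMr//; move: eps_lt1 r1; lra.
Qed.

End SparseFiniteTheorem.

(** * From general probability spaces to finite ones *)

Section MeasureTransfer.
Context {d : measure_display} {Omega : measurableType d} {R : realType}.
Variable P : probability Omega R.

(** The integral of a nonnegative function is a supremum over the simple functions below it. This
    serves for the injective norm, a supremum over infinitely many test families, whose
    measurability is not established. *)
Lemma le_integral_nonmeasurable (f g : Omega -> \bar R) :
  (forall w, 0 <= f w)%E -> (forall w, f w <= g w)%E ->
  (\int[P]_w f w <= \int[P]_w g w)%E.
Proof.
move=> f0 fg; rewrite !ge0_integralTE//; last first.
  by move=> w; exact: le_trans (fg w).
apply: ereal_sup_le => _ [h hf <-]; exists h => // w.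
exact: le_trans (hf w) (fg w).
Qed.

Lemma integral_finite_law (J : finType) (e : Omega -> J) (g : J -> R) :
  (forall j, measurable (e @^-1` [set j])) ->
  (\int[P]_w (g (e w))%:E)%E =
  (\sum_j fine (P (e @^-1` [set j])) * g j)%:E.
Proof.
move=> me.
transitivity (\int[P]_w (\sum_j (g j)%:E * (\1_(e @^-1` [set j]) w)%:E))%E.
  apply: eq_integral => w _; rewrite (bigD1 (e w))//= big1 => [|j jw].
    by rewrite indicE mem_set// mule1 adde0.
  by rewrite indicE memNset ?mule0//= => h; move: jw; rewrite h eqxx.
have int1 j : P.-integrable setT (fun w => (\1_(e @^-1` [set j]) w)%:E).
  exact: integrable_indic.
rewrite integral_sum//; last first.
  by move=> j; apply: integrableZl => //.
rewrite -sumEFin; apply: eq_bigr => j _.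
rewrite integralZl// integral_indic// setIT EFinM muleC fineK//.
exact: fin_num_measure.
Qed.

Lemma measurable_finite_law (J : finType) (e : Omega -> J) (g : J -> R) :
  (forall j, measurable (e @^-1` [set j])) ->
  measurable_fun setT (fun w => (g (e w))).
Proof.
move=> me _ Y _; rewrite setTI.
have -> : (fun w => g (e w)) @^-1` Y =
    \bigcup_(j in [set j | Y (g j)]) (e @^-1` [set j]).
  apply/seteqP; split => [w Yw|w [j /= Yj ej]]; first by exists (e w).
  by rewrite /= ej.
by apply: fin_bigcup_measurable => //; exact: finite_finset.
Qed.

Lemma measurable_max_entry (n r : nat) (X : multi_index n r -> Omega -> R) :
  (forall i, measurable_fun setT (X i)) ->
  measurable_fun setT (fun w => max_entry (fun i => X i w)).
Proof.
move=> mX; rewrite /max_entry.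
elim: (index_enum _) => [|i s IH].
  by under eq_fun do rewrite big_nil; exact: measurable_cst.
under eq_fun do rewrite big_cons.
by apply: measurable_maxr => //; exact: measurableT_comp.
Qed.

Import HBSimple.

(** The identity is approximated in [L^1] of the law of [X]. Approximating by a function of [X]
    preserves independence, and [phi 0 = 0] preserves sparsity. *)
Lemma simple_approx (X : {RV P >-> R}) (eta : R) :
  P.-integrable setT (EFin \o X) -> 0 < eta ->
  exists phi : R -> R, [/\ measurable_fun setT phi, finite_set (range phi),
    phi 0 = 0 & (\int[P]_w `|(X w - phi (X w))%:E| <= eta%:E)%E].
Proof.
move=> iX eta0.
have mX : measurable_fun setT X by exact: measurable_funPT.
have mE := @EFin_measurable R setT.
have imu := integrable_pushforward mX mE iX measurableT.
have [g [ig _ /fine_cvgP[gfin gcvg]]] := approximation_sfun_integrable measurableT imu.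
have : \forall k \near \oo, (\int[pushforward P X]_z `|z%:E - (g k z)%:E| <= eta%:E)%E.
  near=> k.
  have kf : (\int[pushforward P X]_z `|z%:E - (g k z)%:E|)%E \is a fin_num by near: k.
  rewrite -(fineK kf) lee_fin; apply: le_trans (ler_norm _) _.
  by near: k; exact: (cvgr0_norm_le _ gcvg).
case=> k _ /(_ k (leqnn k)) hk.
have mg : measurable_fun setT (g k) by exact: measurable_funPT.
(* Resetting the value at 0 makes the error vanish there and leaves it unchanged elsewhere. *)
pose phi z := if z == 0 then 0 else g k z.
have mphi : measurable_fun setT phi.
  apply: measurable_fun_ifT => //.
  exact: measurable_fun_eqr.
exists phi; split => //.
- apply: (@sub_finite_set _ _ ([set 0] `|` range (g k))).
    by move=> _ [z _ <-]; rewrite /phi; case: eqP => _; [left|right; exists z].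
  by rewrite finite_setU; split; [exact: finite_set1|exact: fimfunP].
- by rewrite /phi eqxx.
have mB : measurable_fun setT (fun z : R => z - g k z) by exact: measurable_funB.
have mA : measurable_fun setT (fun z : R => `|z%:E - (g k z)%:E|%E).
  by apply: measurableT_comp => //; exact/measurable_EFinP.
apply: le_trans hk; rewrite ge0_integral_pushforward//.
rewrite preimage_setT; apply: ge0_le_integral => //.
- apply: measurableT_comp => //; apply/measurable_EFinP; apply: measurable_funB => //.
  exact: measurableT_comp.
- exact: (measurableT_comp mA mX).
move=> w _ /=; rewrite lee_fin /phi; case: eqP => [->|_//].
by rewrite subrr normr0.
Unshelve. all: by end_near.
Qed.

End MeasureTransfer.

Lemma max_entry_ge {R : realType} {n r : nat} (X : tensor R n r) i :
  `|X i| <= max_entry X.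
Proof. exact: (le_bigmax 0 (fun i => `|X i|)). Qed.

Lemma max_entry_ge0 {R : realType} {n r : nat} (X : tensor R n r) : 0 <= max_entry X.
Proof. exact: bigmax_ge_id. Qed.

Lemma max_entry_perturb {R : realType} {n r : nat} (X Y : tensor R n r) :
  max_entry X <= max_entry Y + \sum_i `|Y i - X i|.
Proof.
apply: bigmax_le => [|i _].
  by rewrite addr_ge0 ?max_entry_ge0// sumr_ge0.
rewrite (_ : X i = Y i - (Y i - X i)); last by ring.
apply: le_trans (ler_normB _ _) _; rewrite lerD ?max_entry_ge//.
by rewrite (bigD1 i)//= lerDl sumr_ge0.
Qed.

(** * The bound for integrable random tensors *)

Section SparseRandomTensor.
Context {R : realType} {n r : nat} {d : measure_display} {Omega : measurableType d}.
Variables (P : probability Omega R) (eps : R).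
Local Notation I := (multi_index n r).
Variable T : I -> {RV P >-> R}.
Hypotheses (n_gt0 : (0 < n)%N) (r_gt0 : (0 < r)%N).
Hypotheses (eps_gt0 : 0 < eps) (eps_lt1 : eps < 1).
Hypothesis indep : mutually_independent T.
Hypothesis intT : forall i, P.-integrable [set: Omega] (EFin \o T i).
Hypothesis sparse :
  forall i, (P [set w | T i w != 0%R] <= (n%:R `^ (- 1 - eps))%R%:E)%E.

Local Notation K := (2004 * r%:R ^+ 3 / eps).

Let K_ge0 : 0 <= K.
Proof.
apply: divr_ge0; last exact: ltW.
by apply: mulr_ge0; [exact: ler0n|rewrite exprn_ge0].
Qed.

(** The finite case is applied to the discretised entries. Replacing entries and means costs [2 eta]
    per entry on the left, and replacing the maximum costs [eta] per entry, multiplied by [K], on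
    the right. *)
Lemma expectation_inj_norm_approx (eta : R) : 0 < eta ->
  ('E_P[fun w => inj_norm (fun i => T i w - expected_tensor T i)%R] <=
   K%:E * 'E_P[fun w => max_entry (fun i => T i w)] +
   ((K + 2) * #|{: I}|%:R * eta)%:E)%E.
Proof.
move=> eta0.
have mT i : measurable_fun setT (T i) by exact: measurable_funPT.
have [phi hphi] := boolp.choice (fun i => simple_approx P (T i) eta (intT i) eta0).
have mphi i : measurable_fun setT (phi i) by have [] := hphi i.
have phi0 i : phi i 0 = 0 by have [] := hphi i.
(* A common finite set of values, so that one finite type [V] carries the laws of all entries. *)
have [s sE] : exists s : seq R, \bigcup_(i in [set: I]) range (phi i) = [set` s].
  apply/finite_seqP; apply: bigcup_finite => [|i _]; first exact: finite_finset.
  by have [] := hphi i.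
have hs i z : phi i z \in s.
  have : [set` s] (phi i z) by rewrite -sE; exists i => //; exists z.
  by [].
pose V := seq_sub s.
pose e i w : V := SeqSub (hs i (T i w)).
pose E w : {ffun I -> V} := [ffun i => e i w].
pose B i (v : V) : set R := phi i @^-1` [set ssval v].
have mB i v : measurable (B i v).
  by rewrite /B -[X in measurable X]setTI; apply: mphi.
have eE i v : e i @^-1` [set v] = T i @^-1` B i v.
  apply/seteqP; split => w /=; first by move=> <-.
  by move=> h; apply: val_inj.
have me i v : measurable (e i @^-1` [set v]).
  by rewrite eE; exact: measurable_funPTI.
pose q i v := fine (P (e i @^-1` [set v])).
have qE i v : P (e i @^-1` [set v]) = (q i v)%:E.
  by rewrite fineK// fin_num_measure.
have EE v : E @^-1` [set v] = [set w | forall i, i \in [set: I]%SET -> B i (v i) (T i w)].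
  apply/seteqP; split => w /=.
    by move=> <- i _; rewrite /B /= ffunE.
  move=> h; apply/ffunP => i; rewrite ffunE; apply: val_inj => /=.
  by apply: h; rewrite inE.
have mE v : measurable (E @^-1` [set v]).
  rewrite (_ : E @^-1` [set v] = \bigcap_(i in [set: I]) (e i @^-1` [set v i])).
    by apply: fin_bigcap_measurable => //; exact: finite_finset.
  apply/seteqP; split => w /=; first by move=> <- i _ /=; rewrite ffunE.
  by move=> h; apply/ffunP => i; rewrite ffunE; exact: h.
(* Independence makes the joint law of the discretised entries the product of the marginals
   [q i]. *)
have PE v : fine (P (E @^-1` [set v])) = \prod_i q i (v i).
  rewrite EE (indep [set: I]%SET (fun i => B i (v i)))//.
  rewrite (eq_bigr (fun i => (q i (v i))%:E)) => [|i _]; last by rewrite -eE qE.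
  rewrite prodEFin/=; apply: eq_bigl => i; by rewrite inE.
have lawE (g : {ffun I -> V} -> R) : (\int[P]_w (g (E w))%:E)%E = (prod_exp q g)%:E.
  rewrite integral_finite_law//; congr (_%:E); apply: eq_bigr => v _; by rewrite PE.
have lawe i (g : V -> R) : (\int[P]_w (g (e i w))%:E)%E = (marg_exp q i g)%:E.
  by rewrite integral_finite_law.
have q_ge0 i v : 0 <= q i v by apply: fine_ge0.
have q_sum1 i : \sum_v q i v = 1.
  have := lawe i (fun=> 1); rewrite /= integral_cst//= probability_setT mule1.
  by move=> [->]; apply: eq_bigr => v _; rewrite mulr1.
pose x (i : I) (v : V) : R := ssval v.
have xe i w : x i (e i w) = phi i (T i w) by [].
pose D i w := T i w - phi i (T i w).
have mD i : measurable_fun setT (D i).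
  by apply: measurable_funB => //; exact: measurableT_comp.
have mD' i : measurable_fun setT (fun w => `|(D i w)%:E|%E).
  by apply: measurableT_comp => //; exact/measurable_EFinP.
have ID i : (\int[P]_w `|(D i w)%:E| <= eta%:E)%E by have [] := hphi i.
have iD i : P.-integrable setT (EFin \o D i).
  apply/integrableP; split; first exact/measurable_EFinP.
  exact: le_lt_trans (ID i) (ltry _).
have mean i : `|expected_tensor T i - marg_exp q i (x i)| <= eta.
  have h : (marg_exp q i (x i))%:E = ('E_P[T i] - \int[P]_w (D i w)%:E)%E.
    rewrite -lawe unlock -integralB_EFin//; apply: eq_integral => w _.
    by rewrite xe -EFinB /D; congr (_%:E); ring.
  have f1 : ('E_P[T i])%E \is a fin_num.
    by rewrite unlock; apply: integrable_fin_num => //; exact: intT.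
  have f2 : (\int[P]_w (D i w)%:E)%E \is a fin_num.
    by apply: integrable_fin_num => //; exact: iD.
  have -> : expected_tensor T i - marg_exp q i (x i) = fine (\int[P]_w (D i w)%:E)%E.
    apply: EFin_inj; rewrite EFinB h /expected_tensor !fineK//.
    by rewrite -(fineK f1) -(fineK f2) -!EFinB; congr (_%:E); ring.
  rewrite -lee_fin -abse_EFin fineK//; apply: le_trans (ID i).
  by apply: le_abse_integral => //; exact/measurable_EFinP.
have x_sparse i : marg_exp q i (fun v => (x i v != 0)%:R) <= n%:R `^ (- 1 - eps).
  rewrite -lee_fin -lawe; apply: le_trans (sparse i).
  have mA : measurable [set w | T i w != 0].
    rewrite (_ : [set w | _] = T i @^-1` (~` [set 0])); last first.
      by apply/seteqP; split => w /= /eqP.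
    by apply: measurable_funPTI; exact: measurableC.
  have <- : (\int[P]_w (\1_[set w | T i w != 0] w)%:E)%E = P [set w | T i w != 0].
    by rewrite integral_indic// setIT.
  apply: le_integral_nonmeasurable => w; rewrite lee_fin ?ler0n// indicE.
  case: (eqVneq (T i w) 0) => [h|h]; last first.
    by rewrite mem_set//= ler_nat leq_b1.
  by rewrite xe h phi0 eqxx.
pose c := #|{: I}|%:R : R.
have sumD : (\int[P]_w (\sum_i `|(D i w)%:E|) <= (c * eta)%:E)%E.
  rewrite ge0_integral_sum//.
  have -> : (c * eta)%:E = (\sum_(i : I) eta%:E)%E.
    by rewrite sumEFin sumr_const mulr_natl.
  by apply: lee_sum => i _.
have msumD : measurable_fun setT (fun w => \sum_i `|(D i w)%:E|%E).
  exact: emeasurable_sum.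
have sumD0 w : (0 <= \sum_i `|(D i w)%:E|)%E by apply: sume_ge0.
pose g1 (v : {ffun I -> V}) := inj_norm (fun i => x i (v i) - marg_exp q i (x i)).
pose g2 (v : {ffun I -> V}) := max_entry (fun i => x i (v i)).
have mE1 (g : {ffun I -> V} -> R) : measurable_fun setT (fun w => (g (E w))%:E).
  by apply/measurable_EFinP; exact: measurable_finite_law.
have sumDE w : (\sum_i `|(D i w)%:E|)%E = (\sum_i `|D i w|)%:E by rewrite -sumEFin.
have H1 : ('E_P[fun w => inj_norm (fun i => T i w - expected_tensor T i)%R] <=
    (prod_exp q g1)%:E + (2 * c * eta)%:E)%E.
  rewrite unlock. 
  apply: (@le_trans _ _ (\int[P]_w ((g1 (E w))%:E +
      ((\sum_i `|(D i w)%:E|) + (cst (c * eta)%:E) w)))%E).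
    apply: le_integral_nonmeasurable => w; first by rewrite lee_fin inj_norm_ge0.
    rewrite sumDE -!EFinD lee_fin.
    rewrite (eq_inj_norm _ (fun i => (x i (E w i) - marg_exp q i (x i)) +
       (D i w - (expected_tensor T i - marg_exp q i (x i))))) => [|i]; last first.
      by rewrite ffunE xe /D; ring.
    apply: le_trans (ler_inj_normD n_gt0 _ _) _; rewrite lerD2l.
    apply: le_trans (inj_norm_le_sum n_gt0 _) _.
    have -> : c * eta = \sum_(i : I) eta by rewrite sumr_const mulr_natl.
    rewrite -big_split; apply: ler_sum => i _ /=.
    by apply: le_trans (ler_normB _ _) _; rewrite lerD2l.
  have ce0 : 0 <= c * eta by rewrite mulr_ge0// ltW.
  rewrite ge0_integralD//; last 3 first.
  - by move=> w _; rewrite lee_fin inj_norm_ge0.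
  - by move=> w _; rewrite adde_ge0// lee_fin.
  - by apply: emeasurable_funD => //; exact: measurable_cst.
  rewrite ge0_integralD//.
  rewrite lawE leeD2l// integral_cst//= probability_setT mule1.
  apply: le_trans (leeD sumD (lexx _)) _.
  by rewrite -EFinD lee_fin -mulrA mulr_natl mulr2n.
have H2 : ((prod_exp q g2)%:E <=
    'E_P[fun w => max_entry (fun i => T i w)] + (c * eta)%:E)%E.
  rewrite unlock -lawE.
  apply: (@le_trans _ _ (\int[P]_w ((max_entry (fun i => T i w))%:E +
      \sum_i `|(D i w)%:E|))%E).
    apply: le_integral_nonmeasurable => w; first by rewrite lee_fin max_entry_ge0.
    rewrite sumDE -EFinD lee_fin.
    apply: le_trans (max_entry_perturb _ (fun i => T i w)) _; rewrite lerD2l.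
    by apply: ler_sum => i _; rewrite ffunE xe.
  rewrite ge0_integralD//; last 2 first.
  - by move=> w _; rewrite lee_fin max_entry_ge0.
  - by apply/measurable_EFinP; exact: measurable_max_entry.
  by rewrite leeD2l.
have H3 : prod_exp q g1 <= K * prod_exp q g2.
  exact: (exp_inj_norm_finite q q_ge0 q_sum1 n_gt0 r_gt0 x eps eps_gt0 eps_lt1 x_sparse).
move: K K_ge0 H3 => k k0 H3.
apply: (le_trans H1).
apply: (@le_trans _ _ (k%:E * (prod_exp q g2)%:E + (2 * c * eta)%:E)%E).
  by rewrite leeD2r// -EFinM lee_fin.
have EM0 : (0 <= 'E_P[fun w => max_entry (fun i => T i w)])%E.
  by apply: expectation_ge0 => w; exact: max_entry_ge0.
apply: (@le_trans _ _ (k%:E * ('E_P[fun w => max_entry (fun i => T i w)] + (c * eta)%:E)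
    + (2 * c * eta)%:E)%E).
  by rewrite leeD2r// lee_wpmul2l// lee_fin.
rewrite ge0_muleDr// ?lee_fin ?mulr_ge0 ?(ltW eta0)//.
rewrite -addeA leeD2l// -EFinM -EFinD lee_fin le_eqVlt; apply/orP; left; apply/eqP.
by rewrite -/c mulrA -mulrDl -mulrDl.
Qed.

Lemma expectation_inj_norm_le :
  ('E_P[fun w => inj_norm (fun i => T i w - expected_tensor T i)%R] <=
   K%:E * 'E_P[fun w => max_entry (fun i => T i w)])%E.
Proof.
have := expectation_inj_norm_approx; move: K K_ge0 => k k0 approx.
apply/lee_addgt0Pr => e e0.
pose c := (k + 2) * #|{: I}|%:R.
have c0 : 0 <= c by rewrite mulr_ge0// addr_ge0.
have c1 : 0 < c + 1 by rewrite ltr_wpDl.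
apply: le_trans (approx (e / (c + 1)) _) _.
  by rewrite divr_gt0.
rewrite leeD2l// lee_fin -/c mulrCA ler_piMr ?(ltW e0)// ler_pdivrMr//.
by rewrite mul1r lerDl.
Qed.

End SparseRandomTensor.

(** * From the factor [r^3 / eps] to the stated factor *)

Theorem theorem1p4 (R : realType) :
  exists C : R, 0 < C /\
  forall (n r : nat) (eps : R)
    (d : measure_display) (Omega : measurableType d) (P : probability Omega R)
    (T : multi_index n r -> {RV P >-> R}),
    (1 <= n)%N -> (2 <= r)%N -> 0 < eps -> eps < 1 ->
    mutually_independent T ->
    (forall i, P.-integrable [set: Omega] (EFin \o T i)) ->
    (forall i, (P [set w | T i w != 0%R] <= (n%:R `^ (- 1 - eps))%R%:E)%E) ->
    ('E_P[fun w => inj_norm (fun i => T i w - expected_tensor T i)%R] <=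
     (C * (r%:R ^+ 5 / eps ^+ 2) * ln (r%:R / eps) ^+ 2)%R%:E *
     'E_P[fun w => max_entry (fun i => T i w)])%E.
Proof.
(* Since [r / eps >= 2], the logarithm is at least 1/2; the factor 4 makes up for its square. *)
exists (4 * 2004); split=> [|n r eps d Omega P T n1 r2 e0 e1 indep intT sparse].
  lra.
have r0 : (0 < r)%N by exact: ltnW.
apply: le_trans (expectation_inj_norm_le P eps T n1 r0 e0 e1 indep intT sparse) _.
apply: lee_wpmul2r.
  by apply: expectation_ge0 => w; exact: max_entry_ge0.
rewrite lee_fin.
have r0' : 0 < r%:R :> R by rewrite ltr0n.
have r1 : 1 <= r%:R :> R by rewrite ler1n.
have l2 : 1 / 2 <= ln (r%:R / eps).
  apply: le_trans ln2_ge_half _; rewrite ler_ln ?posrE ?divr_gt0//.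
  rewrite ler_pdivlMr//; have : 2 <= r%:R :> R by rewrite ler_nat.
  lra.
have l4 : 1 / 4 <= ln (r%:R / eps) ^+ 2 by rewrite expr2; nra.
have h : r%:R ^+ 3 / eps <= r%:R ^+ 5 / eps ^+ 2.
  have -> : r%:R ^+ 5 / eps ^+ 2 = (r%:R ^+ 3 / eps) * (r%:R ^+ 2 / eps).
    by field; rewrite gt_eqF.
  rewrite ler_peMr ?divr_ge0 ?exprn_ge0 ?(ltW e0) ?(ltW r0')//.
  rewrite ler_pdivlMr// mul1r; apply: le_trans (ltW e1) _.
  by rewrite exprn_ege1.
have x0 : 0 <= r%:R ^+ 3 / eps by rewrite divr_ge0 ?exprn_ge0 ?(ltW e0).
rewrite -[leLHS]mulrA; move: h x0 l4.
move: (r%:R ^+ 3 / eps) (r%:R ^+ 5 / eps ^+ 2) (ln _ ^+ 2) => a b l h a0 l4.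
have : b * (1 / 4) <= b * l by rewrite ler_wpM2l// (le_trans a0).
lra.
Qed.
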